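(* Suppose $f(n)=\sum_{d\mid n}g(d)$ and that $$\sum_{d\leq x}|g(d)|\ll x^\alpha(\log x)^\theta$$ for some $\alpha\in[0,1)$ and $\theta\geq 0$. Then $$S_f(x)=C_f\,x+O\left(x^{\frac{1+\alpha}{3-\alpha}}(\log x)^\theta\right),$$ where the implied constant depends only on $\alpha$. If $\alpha=0$, then $\theta$ should be replaced by $\max(1,\theta)$ in this error term.
   Context: Here $f$ and $g$ are arithmetic functions (functions on the positive integers), $\lfloor\cdot\rfloor$ denotes the greatest integer function, sums over $n\le x$ or $d\le x$ run over positive integers, and $$S_f(x)=\sum_{n\leq x}f\left(\left\lfloor\frac{x}{n}\right\rfloor\right),\qquad C_f=\sum_{n=1}^\infty\frac{f(n)}{n(n+1)}.$$ The symbols $O$ and $\ll$ have their usual meanings. *)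

(* Defs.v *)
(* Arithmetic functions are functions nat -> R[i] whose value at 0 is never
   used. *)
From HB Require Import structures.
From mathcomp Require Import all_boot all_order all_algebra.
From mathcomp Require Import complex.
From mathcomp Require Import all_classical all_reals all_analysis.

Set Implicit Arguments.
Unset Strict Implicit.
Unset Printing Implicit Defensive.

Import Order.TTheory GRing.Theory Num.Theory.
Import numFieldNormedType.Exports.

Local Open Scope classical_set_scope.
Local Open Scope complex_scope.
Local Open Scope ring_scope.

(* On nonnegative reals Num.truncn is the greatest integer function. *)
Definition floor_sum (R : realType) (f : nat -> R[i]) (x : R) : R[i] :=
  \sum_(1 <= n < (Num.truncn x).+1) f (Num.truncn (x / n%:R)).

(* The topology on R[i] is the one carried by its regular algebra R[i]^o. *)
Definition floor_cst_partial (R : realType) (f : nat -> R[i]) (N : nat)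
    : R[i]^o :=
  \sum_(1 <= n < N) f n / (n * n.+1)%:R.

Definition floor_cst (R : realType) (f : nat -> R[i]) : R[i] :=
  limn (floor_cst_partial f).

(* Main.v *)
Require Import Defs.
From HB Require Import structures.
From mathcomp Require Import all_boot all_order all_algebra.
From mathcomp Require Import complex ring lra zify.
From mathcomp Require Import all_classical all_reals all_analysis.
Set Implicit Arguments.
Unset Strict Implicit.
Unset Printing Implicit Defensive.
Import Order.TTheory GRing.Theory Num.Theory.
Import numFieldNormedType.Exports.
Local Open Scope classical_set_scope.
Local Open Scope complex_scope.
Local Open Scope ring_scope.

(** Why the theorem is true.

    Expanding f over divisors, g(d) occurs in the sum of the f(floor(x/n)) once for
    each n <= x such that d divides floor(x/n). Let A_d be the number of these n. In
    C_f x the coefficient of g(d) is x c_d, where c_d is the sum of 1/(m(m+1)) over the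
    multiples m of d. So the error is at most the sum of |g(d)| |A_d - x c_d|, and the
    only information available on g is the size of the partial sums of |g|. The
    divisors are separated at z = x^(1/(3 - alpha)) and at x.

    For d <= z (lemma [small_divisors]) one needs that A_d - x c_d is
    O(y^(1/3) log x), where y = x/d. This is a form of the Dirichlet divisor problem,
    and it is treated as such. The hyperbola method at sqrt(y) ([count_decomp]) leaves
    four sums of psi(y/(n + b) - c), where psi(u) = u - floor(u) - 1/2 and
    n <= sqrt(y), with b and c in [[0, 1]]; the main terms cancel. On a dyadic block
    such a sum is O(y^(1/3)) by van der Corput's method ([hyp_block]): psi is compared
    with averages over short intervals on either side, which are trigonometric
    polynomials ([psi_sum_bound]), and the exponential sums that appear are bounded
    with the second difference test, itself a consequence of the Kusmin-Landau
    inequality. There are O(log x) blocks.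

    For z < d <= x ([middle_divisors]) there is no need for cancellation. The
    n <= z^(1 - alpha) contribute, up to a constant, the sum of
    (x/n)^alpha (log x)^theta, and for larger n there are O(z^2/d) cases for each d;
    the cut-off z balances these contributions, and both are
    O(z^(1 + alpha) (log x)^theta), which is the error term. For d > x
    ([large_divisors]) only x c_d remains, and x c_d is O(1/d).

    In total the range d <= z gives z^(1 + 2 alpha/3) log x. If alpha > 0 this is
    smaller than the error term by a power of x, which absorbs constants depending
    on theta as soon as x is large. If alpha = 0 it has the same power of x as the error
    term and one logarithm, whence the exponent max(1, theta)
    ([log_cst_absorb]). *)

(** * Exponentials on the unit circle and the Kusmin-Landau inequality *)

Section Exponentials.
Variable R : realType.
Implicit Types (u v t d : R) (n m : nat) (z w : R[i]).

(** The norm of [R[i]] takes its values in [R[i]]; inequalities are easier to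
    handle with the same quantity seen in [R]. *)
Definition cabs z : R := Normc.normc z.

Lemma normCE z : `|z| = (cabs z)%:C.
Proof. by []. Qed.

Lemma cabsE z : cabs z = Num.sqrt (complex.Re z ^+ 2 + complex.Im z ^+ 2).
Proof. by case: z. Qed.

Lemma cabs_ge0 z : 0 <= cabs z.
Proof. by rewrite cabsE sqrtr_ge0. Qed.

Lemma cabsM z w : cabs (z * w) = cabs z * cabs w.
Proof. exact: Normc.normcM. Qed.

Lemma cabsD z w : cabs (z + w) <= cabs z + cabs w.
Proof. exact: le_normcD. Qed.

Lemma cabsN z : cabs (- z) = cabs z.
Proof. exact: normcN. Qed.

Lemma cabsB z w : cabs (z - w) <= cabs z + cabs w.
Proof. by rewrite -(cabsN w) cabsD. Qed.

Lemma cabsR u : cabs u%:C = `|u|.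
Proof. by rewrite cabsE /= expr0n addr0 sqrtr_sqr. Qed.

Lemma cabs0 : cabs 0 = 0.
Proof. exact: Normc.normc0. Qed.

Lemma cabs_sum (I : Type) (r : seq I) (P : pred I) (F : I -> R[i]) :
  cabs (\sum_(i <- r | P i) F i) <= \sum_(i <- r | P i) cabs (F i).
Proof.
elim/big_ind2 : _ => // [|x1 x2 y1 y2 h1 h2]; first by rewrite cabs0.
by apply: le_trans (cabsD _ _) _; apply: lerD.
Qed.

Lemma Re_le_cabs z : `|complex.Re z| <= cabs z.
Proof. by have := normc_ge_Re z; rewrite normCE lecR. Qed.

(** The character e(u) = exp(2 i pi u). *)
Definition expi u : R[i] := cos (2 * pi * u) +i* sin (2 * pi * u).

Lemma expiD u v : expi (u + v) = expi u * expi v.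
Proof.
rewrite /expi mulrDr cosD sinD.
by apply/eqP; rewrite eq_complex /= eqxx /= addrC eqxx.
Qed.

Lemma expi0 : expi 0 = 1.
Proof. by rewrite /expi mulr0 cos0 sin0. Qed.

Lemma cabs_expi u : cabs (expi u) = 1.
Proof. by rewrite cabsE /= cos2Dsin2 sqrtr1. Qed.

Lemma expi1 : expi 1 = 1.
Proof. by rewrite /expi mulr1 mulr_natl cos2pi sin2pi. Qed.

Lemma expiN u : expi (- u) * expi u = 1.
Proof. by rewrite -expiD addNr expi0. Qed.

Lemma expi_nat n : expi n%:R = 1.
Proof. by elim: n => [|n IH]; rewrite ?expi0// -addn1 natrD expiD IH expi1 mulr1. Qed.

Lemma expi_int (k : int) : expi k%:~R = 1.
Proof.
case: (intP k) => [|n|n]; [exact: expi0 | exact: expi_nat |].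
by have := expiN n.+1%:R; rewrite expi_nat mulr1 => <-; rewrite rmorphN.
Qed.

Lemma expiDint u (k : int) : expi (u + k%:~R) = expi u.
Proof. by rewrite expiD expi_int mulr1. Qed.

Lemma sin_double t : sin (2 * t) = 2 * (sin t * cos t).
Proof. by rewrite !mulr_natl sin_mulr2n [cos t * _]mulrC. Qed.

Lemma cos_double t : cos (2 * t) = 2 * cos t ^+ 2 - 1.
Proof. by rewrite !mulr_natl cos_mulr2n. Qed.

(** With c = cos (t/2), the mean value theorem on [[0, t/2]] gives
    sin (t/2) >= c t/2, hence sin t >= c^2 t; and c^2 >= 1/2 because cos t >= 0. *)
Lemma sin_ge_half t : 0 <= t <= pi / 2 -> t / 2 <= sin t.
Proof.
move=> /andP[t0 tp]; have pi0 := pi_gt0 R.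
have [c c_in Hc] : exists2 c, c \in `[0, t / 2]%R &
    sin (t / 2) - sin 0 = cos c * (t / 2 - 0).
  apply: MVT_segment; first by lra.
  by apply: continuous_subspaceT => x; apply: continuous_sin.
move: c_in; rewrite in_itv /= => /andP[c0 c1].
have H1 : cos (t / 2) <= cos c.
  by rewrite leNgt; apply/negP; rewrite ltr_cos ?in_itv /=; first lra; apply/andP; split; lra.
have H2 : 0 <= cos (t / 2) by apply: cos_ge0_pihalf; apply/andP; split; lra.
have H0 : 0 <= cos t by apply: cos_ge0_pihalf; apply/andP; split; lra.
have E2 : t = 2 * (t / 2) by field.
have Hs : t / 2 * cos (t / 2) <= sin (t / 2).
  rewrite sin0 !subr0 in Hc; rewrite Hc mulrC; apply: ler_wpM2r => //; lra.
rewrite {2}E2 sin_double; rewrite E2 cos_double in H0.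
move: H0 Hs; move: (cos _) (sin _) H2 => C S C0 CC CS.
apply: (@le_trans _ _ (t * C ^+ 2)); first by rewrite ler_wpM2l//; lra.
have -> : t * C ^+ 2 = 2 * (t / 2 * C * C) by field.
by rewrite ler_wpM2l// ler_wpM2r.
Qed.

(** Quantitative form of the fact that e(t) stays away from 1 when t stays away
    from the integers; any constant would do. *)
Lemma sin_pi_ge t d : 0 < d -> d <= t <= 1 - d -> d <= sin (pi * t).
Proof.
move=> d0 /andP[dt td]; have pi2 := pi_ge2 R.
have [th|th] := leP t (2^-1).
  apply: le_trans (sin_ge_half _); first by nra.
  by apply/andP; split; nra.
have -> : pi * t = - (pi * (1 - t)) + pi by ring.
rewrite sinDpi sinN opprK.
apply: le_trans (sin_ge_half _); first by nra.
by apply/andP; split; nra.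
Qed.

Definition cotc t : R := cos (pi * t) / (2 * sin (pi * t)).

(** This is 1 / (1 - e(t)). Its real part is constant, so that its total variation
    along a monotone sequence is a difference of two values of [cotc]. *)
Definition geomc t : R[i] := 2^-1 +i* cotc t.

Lemma geomcP t : sin (pi * t) != 0 -> geomc t * (1 - expi t) = 1.
Proof.
move=> s0; rewrite /geomc /expi /cotc.
rewrite -(mulrA 2) cos_double sin_double.
apply/eqP; rewrite eq_complex /=.
have := cos2Dsin2 (pi * t); move: s0; move: (cos _) (sin _) => C S s0 CS.
have HC : C ^+ 2 = 1 - S ^+ 2 by rewrite -CS addrK.
apply/andP; split; apply/eqP; first by field: HC.
by field: HC.
Qed.

Lemma cabs_1Bexpi t : cabs (1 - expi t) = 2 * `|sin (pi * t)|.
Proof.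
rewrite cabsE /=.
rewrite -(mulrA 2) cos_double sin_double.
have := cos2Dsin2 (pi * t); move: (cos _) (sin _) => C S CS.
have HC : C ^+ 2 = 1 - S ^+ 2 by rewrite -CS addrK.
have -> : (1 - (2 * C ^+ 2 - 1)) ^+ 2 + (0 - 2 * (S * C)) ^+ 2 = (2 * S) ^+ 2.
  by ring: HC.
by rewrite sqrtr_sqr normrM ger0_norm.
Qed.

Lemma cabs_geomc t d : 0 < d -> d <= t <= 1 - d -> cabs (geomc t) <= (2 * d)^-1.
Proof.
move=> d0 dt; have Hs := sin_pi_ge d0 dt.
have s0 : 0 < sin (pi * t) by apply: lt_le_trans Hs.
have := congr1 cabs (geomcP (lt0r_neq0 s0)).
rewrite cabsM cabs_1Bexpi gtr0_norm // [cabs 1]Normc.normc1 => E.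
have s20 : 2 * sin (pi * t) != 0 by rewrite mulf_neq0 ?pnatr_eq0 ?gt_eqF.
have -> : cabs (geomc t) = (2 * sin (pi * t))^-1 by rewrite -[LHS](mulfK s20) E mul1r.
by rewrite lef_pV2 ?posrE ?mulr_gt0// ler_wpM2l.
Qed.

Lemma cotc_bound t d : 0 < d -> d <= t <= 1 - d -> `|cotc t| <= (2 * d)^-1.
Proof.
move=> d0 dt; have Hs := sin_pi_ge d0 dt.
have s0 : 0 < sin (pi * t) by apply: lt_le_trans Hs.
rewrite /cotc normrM normfV [`|2 * _|]gtr0_norm ?mulr_gt0//.
rewrite -[leRHS]mul1r; apply: ler_pM; rewrite ?cos_max ?normr_ge0 ?invr_ge0 ?mulr_ge0 ?(ltW s0)//.
by rewrite lef_pV2 ?posrE ?mulr_gt0// ler_wpM2l.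
Qed.

(** Over a common denominator the difference is sin (pi u - pi t). *)
Lemma cotc_decr t u : 0 < t -> t <= u -> u < 1 -> cotc u <= cotc t.
Proof.
move=> t0 tu u1; have pi0 := pi_gt0 R.
have st : 0 < sin (pi * t) by apply: sin_gt0_pi; apply/andP; split; nra.
have su : 0 < sin (pi * u) by apply: sin_gt0_pi; apply/andP; split; nra.
rewrite -subr_ge0.
have -> : cotc t - cotc u = sin (pi * u - pi * t) / (2 * (sin (pi * t) * sin (pi * u))).
  by rewrite sinB /cotc; field; rewrite !gt_eqF.
apply: divr_ge0; last by apply/ltW; rewrite !mulr_gt0.
by apply: sin_ge0_pi; apply/andP; split; nra.
Qed.

(** Write e(f(n)) = w(n) (e(f(n)) - e(f(n+1))) with w(n) = 1 / (1 - e(t(n))),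
    where t(n) is the fractional part of the increment f(n+1) - f(n), and sum by
    parts: what remains is the total variation of w, which telescopes because
    the increments are monotone. *)
Lemma kusmin_landau (f : nat -> R) (a b : nat) (m : int) d : 0 < d -> (a <= b)%N ->
  (forall n, (a <= n < b)%N -> m%:~R + d <= f n.+1 - f n <= m%:~R + 1 - d) ->
  (forall n, (a <= n)%N -> (n.+1 < b)%N -> f n.+1 - f n <= f n.+2 - f n.+1) ->
  cabs (\sum_(a <= n < b) expi (f n)) <= 2 / d.
Proof.
move=> d0 ab Hr Hm.
have dd : 0 <= 2 / d by rewrite divr_ge0// ltW.
move: ab; rewrite leq_eqVlt => /orP[/eqP <-|ab]; first by rewrite big_geq// cabs0.
pose t n := f n.+1 - f n - m%:~R.
have Ht n : (a <= n < b)%N -> d <= t n <= 1 - d.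
  by move=> /Hr /andP[h1 h2]; rewrite /t; apply/andP; split; lra.
have Et n : (a <= n < b)%N -> expi (f n) = geomc (t n) * (expi (f n) - expi (f n.+1)).
  move=> nab; have -> : f n.+1 = f n + (t n + m%:~R) by rewrite /t; ring.
  rewrite [expi (f n + _)]expiD expiDint.
  transitivity (expi (f n) * (geomc (t n) * (1 - expi (t n)))); last by ring.
  rewrite geomcP ?mulr1// gt_eqF//.
  exact: lt_le_trans (sin_pi_ge d0 (Ht _ nab)).
(* The boundary term of the summation by parts is kept on the left, so that
   each step of the induction adds exactly one increment of w. *)
suff claim c : (a < c)%N -> (c <= b)%N ->
    cabs (\sum_(a <= n < c) expi (f n) + geomc (t c.-1) * expi (f c)) <=
      (2 * d)^-1 + (cotc (t a) - cotc (t c.-1)).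
  have ab1 : (a <= b.-1 < b)%N by move: ab; lia.
  have aa : (a <= a < b)%N by rewrite leqnn.
  have := claim _ ab (leqnn b).
  have := cotc_bound d0 (Ht _ ab1); have := cotc_bound d0 (Ht _ aa).
  rewrite !ler_norml => /andP[_ h1] /andP[h2 _] h3.
  set S := \sum_(a <= n < b) _ in h3 *.
  have -> : S = (S + geomc (t b.-1) * expi (f b)) - geomc (t b.-1) * expi (f b).
    by rewrite addrK.
  apply: le_trans (cabsB _ _) _; rewrite [cabs (_ * expi _)]cabsM cabs_expi mulr1.
  have := cabs_geomc d0 (Ht _ ab1).
  have -> : 2 / d = 4 * (2 * d)^-1 by field; rewrite gt_eqF.
  lra.
elim: c => // c IH; rewrite ltnS leq_eqVlt => /orP[/eqP <-{c IH}|ac] cb.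
  rewrite big_nat1 subrr addr0 {1}Et ?leqnn// .
  have -> : forall x y z : R[i], x * (y - z) + x * z = x * y by move=> *; ring.
  rewrite cabsM cabs_expi mulr1; apply: cabs_geomc => //; apply: Ht.
  by rewrite leqnn.
have {IH}IH := IH ac (ltnW cb).
rewrite big_nat_recr; last by rewrite ltnW.
rewrite {1}[expi (f c)]Et; last by rewrite ltnW.
set S := \sum_(_ <= _ < _) _ in IH *.
have -> : S + geomc (t c) * (expi (f c) - expi (f c.+1)) + geomc (t c) * expi (f c.+1)
  = (S + geomc (t c.-1) * expi (f c)) + (geomc (t c) - geomc (t c.-1)) * expi (f c).
  by ring.
apply: le_trans (cabsD _ _) _.
rewrite [cabs (_ * expi _)]cabsM cabs_expi mulr1.
have cc : (a <= c.-1 < b)%N by move: ac cb; lia.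
have c1 : (a <= c < b)%N by move: ac cb; lia.
have tt : t c.-1 <= t c.
  have := Hm c.-1; rewrite prednK ?(leq_ltn_trans _ ac)// /t prednK ?(leq_ltn_trans _ ac)//.
  by case/andP: cc => -> _ /(_ isT cb) ?; rewrite lerD2r.
have -> : cabs (geomc (t c) - geomc (t c.-1)) = cotc (t c.-1) - cotc (t c).
  rewrite cabsE /= subrr expr0n add0r sqrtr_sqr distrC ger0_norm// subr_ge0.
  have /andP[h1 _] := Ht _ cc; have /andP[_ h2] := Ht _ c1.
  by apply: cotc_decr => //; lra.
lra.
Qed.

End Exponentials.

(** * The second difference test for exponential sums *)

Section SecondDifference.
Variable R : realType.
Implicit Types (f : nat -> R) (s l r : R).

Lemma split_monotone (P : nat -> bool) (a b : nat) : (a <= b)%N ->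
  (forall n, (a <= n)%N -> (n.+1 < b)%N -> P n -> P n.+1) ->
  exists c, [/\ (a <= c <= b)%N, forall n, (a <= n < c)%N -> ~~ P n &
                forall n, (c <= n < b)%N -> P n].
Proof.
move=> ab; have [k ->] : exists k, b = (a + k)%N by exists (b - a)%N; lia.
elim: k {ab} => [|k IH] Pm.
  by exists a; split=> [|n|n]; try lia.
have [|c [ac h1 h2]] := IH; first by move=> n an nk; apply: Pm => //; lia.
have [ck|ck] := ltnP c (a + k).
  exists c; split=> //; first by lia.
  move=> n cn; have [->|nk] := eqVneq n (a + k)%N; last by apply: h2; lia.
  rewrite -(@prednK (a + k)); last by lia.
  by apply: Pm; [lia | lia | apply: h2; lia].
case Pk : (P (a + k)%N).
  exists (a + k)%N; split; first by lia.
    by move=> n nk; apply: h1; lia.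
  by move=> n nk; have -> : n = (a + k)%N by lia.
exists (a + k.+1)%N; split; first by lia.
  move=> n nk; have [->|nk'] := eqVneq n (a + k)%N; first by rewrite Pk.
  by apply: h1; lia.
by move=> n; lia.
Qed.

Lemma cabs_sum_expi f (a b : nat) :
  cabs (\sum_(a <= n < b) expi (f n)) <= (b - a)%:R.
Proof.
apply: le_trans (cabs_sum _ _ _) _.
by under eq_bigr do rewrite cabs_expi; rewrite sumr_const_nat.
Qed.

(** Discrete substitute for a lower bound l on the second derivative of f. *)
Definition convex_by l f (a b : nat) :=
  forall n, (a <= n)%N -> (n.+1 < b)%N -> f n.+1 - f n + l <= f n.+2 - f n.+1.

Lemma convex_by_sub l f (a b a' b' : nat) : (a <= a')%N -> (b' <= b)%N ->
  convex_by l f a b -> convex_by l f a' b'.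
Proof. by move=> aa bb cf n an nb; apply: cf; lia. Qed.

Lemma convex_by_growth l f (a b n : nat) : convex_by l f a b -> (a <= n < b)%N ->
  f a.+1 - f a + (n - a)%:R * l <= f n.+1 - f n.
Proof.
move=> cf; elim: n => [|n IH] nab.
  by move: nab; rewrite leqn0 => /andP[/eqP -> _]; rewrite subnn mul0r addr0 lexx.
have [->|na] := eqVneq a n.+1; first by rewrite subnn mul0r addr0 lexx.
have H : (a <= n < b)%N by lia.
have := cf n; case/andP: nab => _ nb.
have an : (a <= n)%N by lia.
move=> /(_ an nb); have := IH H.
rewrite subSn// -natr1; lra.
Qed.

(** Increments that grow by at least s^2 at each step leave an interval of length
    s after 1/s steps. *)
Lemma convex_by_count s f (a b : nat) (c : R) : 0 < s <= 1 -> convex_by (s ^+ 2) f a b ->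
  (forall n, (a <= n < b)%N -> c <= f n.+1 - f n <= c + s) ->
  (b - a)%:R <= 2 / s.
Proof.
move=> /andP[s0 s1] cf H.
have ds : 1 <= s^-1 by rewrite invr_ge1 ?unitfE ?gt_eqF// posrE.
have [ab|ba] := ltnP a b; last first.
  have -> : (b - a = 0)%N by lia.
  by rewrite divr_ge0// ltW.
have hb : (a <= b.-1 < b)%N by lia.
have ha : (a <= a < b)%N by lia.
have := convex_by_growth cf hb.
have /andP[h1 _] := H _ ha; have /andP[_ h2] := H _ hb => h3.
have h4 : (b.-1 - a)%:R * s ^+ 2 <= s by lra.
have -> : (b - a = (b.-1 - a).+1)%N by lia.
rewrite -natr1.
have : (b.-1 - a)%:R <= s^-1.
  rewrite -(ler_pM2r (_ : 0 < s ^+ 2)) ?exprn_gt0// expr2 [leRHS]mulrA.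
  by rewrite mulVf ?gt_eqF// mul1r -expr2.
lra.
Qed.

(** All the increments lie between two consecutive integers. Those within s of
    either end are at most 2/s in number, and the Kusmin-Landau inequality with
    distance s handles the others: the choice of s balances both bounds. *)
Lemma expi_sum_window s f (a b : nat) (m : int) : 0 < s <= 1 -> (a <= b)%N ->
  convex_by (s ^+ 2) f a b ->
  (forall n, (a <= n < b)%N -> m%:~R <= f n.+1 - f n <= m%:~R + 1) ->
  cabs (\sum_(a <= n < b) expi (f n)) <= 6 / s.
Proof.
move=> s01 ab cf H; have /andP[s0 s1] := s01.
have mon n : (a <= n)%N -> (n.+1 < b)%N -> f n.+1 - f n <= f n.+2 - f n.+1.
  by move=> an nb; apply: le_trans (cf _ an nb); rewrite lerDl sqr_ge0.
have [|c1 [c1ab lo1 hi1]] := @split_monotone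
  (fun n => m%:~R + s <= f n.+1 - f n) _ _ ab.
  by move=> n an nb; move/le_trans; apply; apply: mon.
have c1b : (c1 <= b)%N by lia.
have [|c2 [c2ab lo2 hi2]] := @split_monotone
  (fun n => m%:~R + 1 - s < f n.+1 - f n) _ _ c1b.
  by move=> n an nb; move/lt_le_trans; apply; apply: mon; lia.
rewrite (@big_cat_nat _ _ _ c1)/=; [|lia|lia].
rewrite (@big_cat_nat _ _ _ c2 c1)/=; [|lia|lia].
have B1 : cabs (\sum_(a <= n < c1) expi (f n)) <= 2 / s.
  apply: le_trans (cabs_sum_expi _ _ _) _.
  apply: (@convex_by_count _ f _ _ m%:~R) => //.
    by apply: convex_by_sub cf; lia.
  move=> n nac; have := lo1 _ nac; rewrite -ltNge => /ltW ->.
  by have /andP[-> _] := H n ltac:(lia).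
have B2 : cabs (\sum_(c1 <= n < c2) expi (f n)) <= 2 / s.
  apply: (@kusmin_landau _ _ _ _ m) => //; first by lia.
    move=> n nc; rewrite hi1; last by lia.
    by have := lo2 _ nc; rewrite -leNgt.
  by move=> n cn nc; apply: mon; lia.
have B3 : cabs (\sum_(c2 <= n < b) expi (f n)) <= 2 / s.
  apply: le_trans (cabs_sum_expi _ _ _) _.
  apply: (@convex_by_count _ f _ _ (m%:~R + 1 - s)) => //.
    by apply: convex_by_sub cf; lia.
  move=> n nac; have /ltW -> := hi2 _ nac.
  by rewrite subrK; have /andP[_ ->] := H n ltac:(lia).
apply: le_trans (cabsD _ _) _.
have -> : 6 / s = 2 / s + (2 / s + 2 / s) by field; rewrite gt_eqF.
by apply: lerD => //; apply: le_trans (cabsD _ _) _; apply: lerD.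
Qed.

Lemma expi_sum_windows s f (k a b : nat) (m : int) : 0 < s <= 1 -> (a <= b)%N ->
  convex_by (s ^+ 2) f a b ->
  (forall n, (a <= n < b)%N -> m%:~R <= f n.+1 - f n <= m%:~R + k.+1%:R) ->
  cabs (\sum_(a <= n < b) expi (f n)) <= k.+1%:R * (6 / s).
Proof.
move=> s01; elim: k a m => [|k IH] a m ab cf H.
  by rewrite mul1r; apply: (@expi_sum_window _ _ _ _ m).
have [|c [cab lo hi]] := @split_monotone
  (fun n => m%:~R + 1 < f n.+1 - f n) _ _ ab.
  move=> n an nb; move/lt_le_trans; apply; apply: le_trans (cf _ an nb).
  by rewrite lerDl sqr_ge0.
rewrite (@big_cat_nat _ _ _ c)/=; [|lia|lia].
apply: le_trans (cabsD _ _) _; rewrite -[k.+2]add1n natrD mulrDl mul1r.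
apply: lerD.
  apply: (@expi_sum_window _ _ _ _ m) => //; first lia.
    by apply: convex_by_sub cf; lia.
  move=> n nac; have /andP[-> _] := H n ltac:(lia).
  by have := lo _ nac; rewrite -leNgt.
apply: (IH _ (m + 1)); first lia.
  by apply: convex_by_sub cf; lia.
move=> n nac; have /ltW := hi _ nac; rewrite intrD => -> /=.
have /andP[_] := H n ltac:(lia); rewrite -addrA nat1r; lra.
Qed.

(** Van der Corput's second derivative test: the increments cross at most r + 2
    windows between consecutive integers, and each contributes O(l^(-1/2)). *)
Lemma second_difference_test l r f (a b : nat) : 0 < l <= 1 -> 0 <= r -> (a <= b)%N ->
  convex_by l f a b ->
  (forall n, (a <= n < b)%N -> f n.+1 - f n <= f a.+1 - f a + r) ->
  cabs (\sum_(a <= n < b) expi (f n)) <= 6 * (r + 2) / Num.sqrt l.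
Proof.
move=> /andP[l0 l1] r0 ab cf H.
have s01 : 0 < Num.sqrt l <= 1.
  by rewrite sqrtr_gt0 l0 -sqrtr1 ler_wsqrtr.
have cf' : convex_by (Num.sqrt l ^+ 2) f a b by rewrite sqr_sqrtr// ltW.
pose m := Num.floor (f a.+1 - f a).
pose k := (Num.truncn r).+1.
have B := @expi_sum_windows _ f k a b m s01 ab cf'.
have /andP[m1 m2] := floor_itv (f a.+1 - f a).
have := truncn_itv r0 => /andP[k1 k2].
apply: le_trans (B _) _.
  move=> n nab; have := H _ nab; have := convex_by_growth cf nab.
  have : 0 <= (n - a)%:R * l by rewrite mulr_ge0// ltW.
  move: k2 m1 m2; rewrite intrD /k /m -!(natr1 _.+1) -!natr1; lra.
rewrite mulrCA -mulrA; apply: ler_wpM2l => //; apply: ler_wpM2r.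
  by rewrite invr_ge0 sqrtr_ge0.
by rewrite /k -!natr1; lra.
Qed.

End SecondDifference.

(** * The sawtooth function and its finite Fourier expansion *)

Section Sawtooth.
Variable R : realType.
Implicit Types (u v t : R) (q Q V h k n j : nat).

Definition psi u : R := u - (Num.floor u)%:~R - 2^-1.

Lemma psi_bound u : `|psi u| <= 2^-1.
Proof.
have /andP[h1 h2] := floor_itv u; rewrite intrD in h2.
by rewrite /psi ler_norml; apply/andP; split; lra.
Qed.

Lemma psiDint u (k : int) : psi (u + k%:~R) = psi u.
Proof. by rewrite /psi floorDrz ?intr_int// intrKfloor intrD; ring. Qed.

Lemma psi_unit u : 0 <= u < 1 -> psi u = u - 2^-1.
Proof.
move=> u01; rewrite /psi (_ : Num.floor u = 0) ?subr0//.
by apply: floor_def; rewrite add0r.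
Qed.

(** The jumps of psi all go down; this one-sided Lipschitz property is what allows
    psi to be replaced by its averages over short intervals on either side. *)
Lemma psi_lip u v : u <= v -> psi v <= psi u + (v - u).
Proof.
move=> uv; rewrite /psi.
by have := le_floor uv; rewrite -(ler_int R); lra.
Qed.

Lemma expiX n t : expi (n%:R * t) = expi t ^+ n.
Proof.
elim: n => [|n IH]; first by rewrite mul0r expi0.
by rewrite -nat1r mulrDl mul1r expiD IH exprS.
Qed.

Lemma sin_pi_neq0 h Q : (0 < h < Q)%N -> sin (pi * (h%:R / Q%:R)) != 0 :> R.
Proof.
move=> hQ; rewrite gt_eqF// (lt_le_trans _ (@sin_pi_ge _ _ Q%:R^-1 _ _))//.
- by rewrite invr_gt0 ltr0n; lia.
- by rewrite invr_gt0 ltr0n; lia.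
have Q0 : 0 < Q%:R :> R by rewrite ltr0n; lia.
rewrite -[X in X <= _]mul1r ler_pM2r ?invr_gt0// ler_pdivrMr//.
rewrite mulrBl mulVf ?gt_eqF// mul1r ler1n -(ler_nat R) in hQ *.
have : (h.+1 <= Q)%N by lia.
rewrite -(ler_nat R) -natr1 lerBrDr => ->; rewrite andbT.
by case/andP: hQ.
Qed.

Lemma expi_neq1 h Q : (0 < h < Q)%N -> expi (h%:R / Q%:R : R) != 1.
Proof.
move=> hQ; apply/eqP => E; have := @cabs_1Bexpi R (h%:R / Q%:R).
rewrite E subrr cabs0 => /eqP; rewrite eq_sym mulf_eq0 pnatr_eq0 /= normr_eq0.
by rewrite (negPf (sin_pi_neq0 hQ)).
Qed.

Lemma sum_expi_roots h Q : (0 < h < Q)%N ->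
  \sum_(0 <= j < Q) expi (j%:R * (h%:R / Q%:R) : R) = 0.
Proof.
move=> hQ; under eq_bigr do rewrite expiX.
rewrite big_mkord; have := subrX1 (expi (h%:R / Q%:R : R)) Q.
rewrite -expiX mulrC divfK; last by rewrite pnatr_eq0; lia.
rewrite expi_nat subrr => /esym/eqP; rewrite mulf_eq0 subr_eq0.
by rewrite (negPf (expi_neq1 hQ)) => /eqP.
Qed.

Lemma geomc_shift t : sin (pi * t) != 0 -> geomc (1 - t) * (expi t - 1) = expi t.
Proof.
move=> s0; have s1 : sin (pi * (1 - t)) != 0.
  by rewrite mulrBr mulr1 addrC sinDpi sinN opprK.
have -> : expi t - 1 = (1 - expi (1 - t)) * expi t.
  by rewrite mulrBl mul1r -expiD subrK expi1.
by rewrite mulrA geomcP// mul1r.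
Qed.

Definition dft Q t : R[i] :=
  \sum_(1 <= h < Q) geomc (1 - h%:R / Q%:R) * expi (h%:R * t).

(** By [geomc_shift], one step of the grid changes the sum by the sum of e(h i/Q)
    over h from 1 to Q - 1, which is -1. So the values form an arithmetic
    progression, and its first term is found from the fact that their total over a
    period vanishes. *)
Lemma dft_nat Q j : (j < Q)%N -> dft Q (j%:R / Q%:R) = (Q%:R - 1) / 2 - j%:R.
Proof.
move=> jQ; have Q0 : Q%:R != 0 :> R by rewrite pnatr_eq0; lia.
have Q0' : Q%:R != 0 :> R[i] by rewrite pnatr_eq0; lia.
have step i : (i.+1 < Q)%N -> dft Q (i.+1%:R / Q%:R) = dft Q (i%:R / Q%:R) - 1.
  move=> iQ; have := @sum_expi_roots i.+1 Q iQ; rewrite big_ltn; last by lia.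
  rewrite mul0r expi0 => /eqP; rewrite addrC addr_eq0 => /eqP E.
  apply/eqP; rewrite addrC -subr_eq -E -sumrB; apply/eqP.
  apply: eq_big_nat => h hQ.
  rewrite -mulrBr.
  have -> : h%:R * (i.+1%:R / Q%:R) = h%:R * (i%:R / Q%:R) + h%:R / Q%:R :> R.
    by rewrite -natr1; field.
  rewrite expiD -{2}[expi (_ * _)]mulr1 -mulrBr mulrCA geomc_shift//.
  exact: sin_pi_neq0.
have lin i : (i < Q)%N -> dft Q (i%:R / Q%:R) = dft Q 0 - i%:R.
  elim: i => [|i IH] iQ; first by rewrite mul0r subr0.
  by rewrite step// IH ?(ltnW iQ)// -natr1; ring.
have tot : \sum_(0 <= i < Q) dft Q (i%:R / Q%:R : R) = 0.
  rewrite /dft exchange_big /= big_nat_cond big1// => h; rewrite andbT => hQ.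
  rewrite -big_distrr /=.
  under eq_bigr do rewrite mulrCA.
  by rewrite sum_expi_roots// mulr0.
rewrite lin//; congr (_ - _).
move: tot; rewrite (eq_big_nat _ _ (F2 := fun i => dft Q 0 - i%:R)); last by move=> i /lin.
rewrite sumrB sumr_const_nat subn0 -natr_sum.
have -> : (\sum_(0 <= i < Q) i = 'C(Q, 2))%N by rewrite bin2_sum.
move=> /eqP; rewrite subr_eq0 -(mulr_natl (dft Q 0) Q) => /eqP E.
have E2 : ('C(Q, 2) * 2 = Q * Q.-1)%N by rewrite mulnC -mul_bin_diag bin1.
have := congr1 (fun n => n%:R : R[i]) E2; rewrite !natrM -E -subn1 natrB; last by lia.
move=> E3; apply: (mulfI Q0'); apply: (@mulIf _ 2); first by rewrite pnatr_eq0.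
by rewrite E3; field.
Qed.

(** Working on the grid of the multiples of 1/Q makes the Fourier expansion of psi
    a finite identity, without any question of convergence; the mean value
    of psi on this grid is -1/(2Q). *)
Lemma dft_sawtooth Q (j : int) : (0 < Q)%N ->
  (psi (j%:~R / Q%:R) + (2 * Q%:R)^-1)%:C = - (Q%:R)^-1 * dft Q (j%:~R / Q%:R).
Proof.
move=> Q0; have Qn0 : Q%:R != 0 :> R by rewrite pnatr_eq0; lia.
have Qc0 : Q%:R != 0 :> R[i] by rewrite pnatr_eq0; lia.
have Qz0 : (0 < Q%:Z) by lia.
pose i := `|(j %% Q%:Z)%Z|%N.
have iQ : (i < Q)%N.
  by have := ltz_pmod j Qz0; have := modz_ge0 j (lt0r_neq0 Qz0); rewrite /i; lia.
have E : j%:~R / Q%:R = i%:R / Q%:R + (j %/ Q%:Z)%Z%:~R :> R.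
  have Ei : i%:R = (j %% Q%:Z)%Z%:~R :> R.
    by rewrite /i natr_absz ger0_norm// modz_ge0// lt0r_neq0.
  by rewrite {1}(divz_eq j Q%:Z) intrD intrM Ei; field.
rewrite E psiDint.
have -> : dft Q (i%:R / Q%:R + (j %/ Q%:Z)%Z%:~R) = dft Q (i%:R / Q%:R).
  rewrite /dft; apply: eq_bigr => h _; rewrite mulrDr.
  by rewrite -[h%:R * _%:~R](intrM _ h%:Z) expiDint.
rewrite dft_nat// psi_unit; last first.
  rewrite divr_ge0//= ltr_pdivrMr ?ltr0n// mul1r ltr_nat//.
rewrite !(rmorphD, rmorphN, rmorphM, fmorphV, rmorph_nat) /=.
by field; rewrite Qc0.
Qed.

End Sawtooth.

(** * Averages of the sawtooth function over short intervals *)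

Section BoxAverage.
Variable R : realType.
Implicit Types (u v t d : R) (q Q V h k n j m : nat).

Lemma norm_sin_le t : `|sin t| <= `|t|.
Proof.
wlog t0 : t / 0 <= t => [H|].
  have [/H//|/ltW] := leP 0 t.
  by rewrite -oppr_ge0 -(normrN t) -(normrN (sin t)) -sinN => /H.
have [c _] : exists2 c, c \in `[0, t]%R & sin t - sin 0 = cos c * (t - 0).
  apply: MVT_segment => //.
  by apply: continuous_subspaceT => x; apply: continuous_sin.
rewrite sin0 !subr0 => ->; rewrite normrM.
by rewrite ler_piMl// cos_max.
Qed.

Lemma cabs_expiB u v : cabs (expi u - expi v) <= 8 * `|u - v|.
Proof.
have -> : expi u - expi v = - (expi v * (1 - expi (u - v))).
  have -> : expi u = expi (u - v) * expi v by rewrite -expiD subrK.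
  by ring.
rewrite cabsN cabsM cabs_expi mul1r cabs_1Bexpi.
apply: le_trans (ler_wpM2l _ (norm_sin_le _)) _ => //.
have := @pihalf_lt2 R; have := pi_gt0 R => p0 p2.
rewrite normrM gtr0_norm// mulrA; apply: ler_wpM2r => //; lra.
Qed.

Lemma cabs_sum_expiN (a b : nat) (F : nat -> R) :
  cabs (\sum_(a <= n < b) expi (- F n)) = cabs (\sum_(a <= n < b) expi (F n)).
Proof.
have E t : expi (- t) = conjc (expi t) by rewrite /expi mulrN cosN sinN.
under eq_bigr do rewrite E.
rewrite -(raddf_sum (@conjc R)).
by case: (\sum_(a <= n < b) _) => x y; rewrite !cabsE /= sqrrN.
Qed.

Lemma sum_inv_sqrt n : \sum_(1 <= k < n.+1) (Num.sqrt k%:R)^-1 <= 2 * Num.sqrt n%:R :> R.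
Proof.
elim: n => [|n IH]; first by rewrite big_geq// sqrtr0 mulr0.
rewrite big_nat_recr//=; apply: le_trans (lerD IH (lexx _)) _.
have b0 : 0 < Num.sqrt n.+1%:R :> R by rewrite sqrtr_gt0 ltr0n.
have a0 : 0 <= Num.sqrt n%:R :> R by rewrite sqrtr_ge0.
have E : Num.sqrt n.+1%:R ^+ 2 = Num.sqrt n%:R ^+ 2 + 1 :> R.
  by rewrite !sqr_sqrtr ?ler0n// natr1.
move: (Num.sqrt n.+1%:R) (Num.sqrt n%:R) b0 a0 E => b a b0 a0 E.
rewrite -lerBrDl -mulrBr -(ler_pM2r b0) mulVf ?gt_eqF//.
have ab : a <= b by rewrite -(@ler_pXn2r _ 2) ?nnegrE ?(ltW b0)// E lerDl.
nra.
Qed.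

(** Pairs the frequencies h and Q - h, that is k and -k, when Q = 2q + 1. *)
Lemma fold_sum (F : nat -> R[i]) q :
  \sum_(1 <= h < q.*2.+1) F h = \sum_(1 <= k < q.+1) (F k + F (q.*2.+1 - k)%N).
Proof.
rewrite (@big_cat_nat _ _ _ q.+1)/=; [|lia|lia].
rewrite big_split /=; congr (_ + _).
rewrite -[in LHS](add1n q) big_addn (_ : (q.*2.+1 - q = q.+1)%N); last by lia.
rewrite big_nat_rev /=.
by apply: eq_big_nat => k hk; congr F; lia.
Qed.

(** Up to a constant, a bound for the k-th Fourier coefficient of psi averaged over
    an interval of length 1/H: the coefficient 1/k of psi itself is damped beyond
    the frequency H. *)
Definition freq_weight (H : R) k : R := Num.min (k%:R^-1) (H / k%:R ^+ 2).

Lemma freq_weight_ge0 (H : R) k : 0 <= H -> 0 <= freq_weight H k.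
Proof.
by move=> H0; rewrite /freq_weight le_min invr_ge0 ler0n divr_ge0.
Qed.

Definition box_sum (e : int) Q V h : R[i] :=
  \sum_(0 <= r < V) expi (r%:R * (e%:~R * (h%:R / Q%:R)) : R).

(** Averaging over the V points j + e r with r < V, where e = 1 or -1, multiplies
    the coefficient of frequency h by a normalised geometric sum. *)
Definition box_coef (e : int) Q V h : R[i] :=
  - (Q%:R^-1 / V%:R) * (geomc (1 - h%:R / Q%:R) * box_sum e Q V h).

(** The geometric sum is at most V, and at most Q/k because its ratio is at
    distance at least 2k/Q from 1. *)
Lemma box_coef_bound (e : int) Q V h k : (e == 1) || (e == -1) ->
  (0 < k)%N -> (0 < V)%N -> (k <= h <= Q - k)%N -> (k < Q)%N ->
  cabs (box_coef e Q V h) <= freq_weight (Q%:R / V%:R) k / 2.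
Proof.
move=> e1 k0 V0 hk kQ.
have Q0 : 0 < Q%:R :> R by rewrite ltr0n; lia.
have kr0 : 0 < k%:R :> R by rewrite ltr0n.
have Vr0 : 0 < V%:R :> R by rewrite ltr0n.
pose d : R := k%:R / Q%:R.
have d0 : 0 < d by rewrite divr_gt0.
have ht : d <= h%:R / Q%:R <= 1 - d.
  rewrite /d ler_pM2r ?invr_gt0// ler_nat; case/andP: hk => -> hQ /=.
  rewrite -[X in X - _](divff (lt0r_neq0 Q0)) -mulrBl ler_pM2r ?invr_gt0//.
  by rewrite -natrB 1?ltnW// ler_nat.
have B1 : cabs (geomc (1 - h%:R / Q%:R)) <= (2 * d)^-1.
  by apply: cabs_geomc => //; apply/andP; split; case/andP: ht; lra.
have B2 : cabs (box_sum e Q V h) <= V%:R.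
  by apply: le_trans (cabs_sum_expi _ _ _) _; rewrite subn0.
have B3 : cabs (box_sum e Q V h) <= d^-1.
  pose z : R[i] := expi (e%:~R * (h%:R / Q%:R)).
  have Ez : z ^+ V - 1 = (z - 1) * box_sum e Q V h.
    rewrite subrX1 /box_sum big_mkord; congr (_ * _).
    by apply: eq_bigr => r _; rewrite expiX.
  have := congr1 (@cabs R) Ez; rewrite cabsM.
  have -> : cabs (z - 1) = 2 * sin (pi * (h%:R / Q%:R)).
    rewrite -cabsN opprB cabs_1Bexpi; congr (_ * _).
    have s0 : 0 <= sin (pi * (h%:R / Q%:R)) :> R by exact: (le_trans (ltW d0) (sin_pi_ge d0 ht)).
    case/orP: e1 => /eqP ->; first by rewrite mul1r ger0_norm.
    by rewrite mulN1r mulrN sinN normrN ger0_norm.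
  have Hz : cabs (z ^+ V - 1) <= 2.
    apply: le_trans (cabsB _ _) _; rewrite -expiX cabs_expi [cabs 1]Normc.normc1; lra.
  move=> Es; rewrite Es in Hz.
  have Hs := sin_pi_ge d0 ht.
  have H0 := cabs_ge0 (box_sum e Q V h).
  rewrite -(ler_pM2l d0) mulfV ?gt_eqF//.
  have := ler_wpM2r H0 Hs; lra.
have EQ : cabs (- (Q%:R^-1 / V%:R) : R[i]) = (Q%:R * V%:R)^-1.
  have -> : (- (Q%:R^-1 / V%:R) : R[i]) = (- (Q%:R * V%:R)^-1)%:C.
    by rewrite !(rmorphN, fmorphV, rmorphM, rmorph_nat) /= invfM.
  by rewrite cabsR normrN gtr0_norm// invr_gt0 mulr_gt0.
rewrite /box_coef !cabsM EQ /freq_weight.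
have P0 : 0 < (Q%:R * V%:R : R)^-1 by rewrite invr_gt0 mulr_gt0.
have [C0 C1] := (cabs_ge0 (geomc (1 - h%:R / Q%:R : R)), cabs_ge0 (box_sum e Q V h)).
have M : Num.min (k%:R^-1) (Q%:R / V%:R / k%:R ^+ 2) / 2
    = (Q%:R * V%:R)^-1 * ((2 * d)^-1 * Num.min V%:R d^-1).
  rewrite minr_pMl ?invr_ge0// mulrA minr_pMr; last first.
    by rewrite mulr_ge0 ?(ltW P0)// invr_ge0 mulr_ge0// ltW.
  congr Num.min.
    by rewrite /d; field; rewrite !gt_eqF.
  by rewrite /d; field; rewrite !gt_eqF.
rewrite M; apply: ler_wpM2l; first exact: ltW.
by apply: ler_pM => //; rewrite le_min B2 B3.
Qed.

Lemma box_average (e : int) q V (g : int) : (0 < V)%N -> let Q := q.*2.+1 in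
  (V%:R^-1 * (\sum_(0 <= r < V) psi ((g + e * r%:Z)%:~R / Q%:R)) + (2 * Q%:R)^-1 : R)%:C
  = \sum_(1 <= k < q.+1) (box_coef e Q V k * expi (k%:R * (g%:~R / Q%:R))
      + box_coef e Q V (Q - k)%N * expi (- (k%:R * (g%:~R / Q%:R)))).
Proof.
move=> V0 Q; have Q0 : (0 < Q)%N by [].
have Qn0 : Q%:R != 0 :> R by rewrite pnatr_eq0.
have Qc0 : Q%:R != 0 :> R[i] by rewrite pnatr_eq0.
have Vn0 : V%:R != 0 :> R by rewrite pnatr_eq0; lia.
have Vc0 : V%:R != 0 :> R[i] by rewrite pnatr_eq0; lia.
transitivity (\sum_(1 <= h < Q) box_coef e Q V h * expi (h%:R * (g%:~R / Q%:R) : R)); last first.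
  rewrite [LHS]fold_sum; apply: eq_big_nat => k hk; congr (_ + _ * _).
  rewrite natrB; last by rewrite /Q; lia.
  have -> : (Q%:R - k%:R) * (g%:~R / Q%:R) = - (k%:R * (g%:~R / Q%:R)) + g%:~R :> R.
    by field.
  by rewrite expiDint.
have -> : V%:R^-1 * (\sum_(0 <= r < V) psi ((g + e * r%:Z)%:~R / Q%:R)) + (2 * Q%:R)^-1
   = V%:R^-1 * (\sum_(0 <= r < V) (psi ((g + e * r%:Z)%:~R / Q%:R) + (2 * Q%:R)^-1)) :> R.
  rewrite [in RHS]big_split sumr_const_nat subn0 -[X in _ * (_ + X)]mulr_natl.
  by field; rewrite Qn0 Vn0.
rewrite rmorphM fmorphV rmorph_nat rmorph_sum /=.
under eq_bigr do rewrite dft_sawtooth//.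
rewrite -big_distrr /= /dft exchange_big /=.
rewrite mulrA big_distrr /=; apply: eq_bigr => h _.
rewrite /box_coef -big_distrr /=.
have -> : \sum_(0 <= r < V) expi (h%:R * ((g + e * r%:Z)%:~R / Q%:R) : R)
   = expi (h%:R * (g%:~R / Q%:R)) * box_sum e Q V h.
  rewrite /box_sum big_distrr /=; apply: eq_bigr => r _; rewrite -expiD; congr expi.
  by rewrite intrD intrM; field.
by field; rewrite Qc0 Vc0.
Qed.

End BoxAverage.

(** * From sums of the sawtooth function to exponential sums *)

Section SawtoothSums.
Variable R : realType.
Implicit Types (u v t d : R) (q Q V h k n j m : nat).

(** The trigonometric polynomial that interpolates, at the points of the grid, the
    average of psi over V points on one side, shifted by 1/(2Q) to have mean 0. *)
Definition box_trig (e : int) q V u : R[i] :=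
  \sum_(1 <= k < q.+1) (box_coef R e q.*2.+1 V k * expi (k%:R * u)
      + box_coef R e q.*2.+1 V (q.*2.+1 - k)%N * expi (- (k%:R * u))).

Lemma box_trig_sum (e : int) q V (u : nat -> R) (a b : nat) :
  (e == 1) || (e == -1) -> (0 < V)%N ->
  cabs (\sum_(a <= n < b) box_trig e q V (u n)) <=
    \sum_(1 <= k < q.+1) freq_weight (q.*2.+1%:R / V%:R) k
                          * cabs (\sum_(a <= n < b) expi (k%:R * u n)).
Proof.
move=> e1 V0; rewrite /box_trig exchange_big /=.
apply: le_trans (cabs_sum _ _ _) _.
apply: ler_sum_nat => k kq; rewrite big_split /= -!big_distrr /=.
apply: le_trans (cabsD _ _) _; rewrite [cabs (box_coef _ _ _ _ k * _)]cabsM.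
rewrite [cabs (box_coef _ _ _ _ (_ - _) * _)]cabsM cabs_sum_expiN -mulrDl.
apply: ler_wpM2r; first exact: cabs_ge0.
rewrite [leRHS]splitr; apply: lerD; apply: box_coef_bound => //; lia.
Qed.

(** The sum of k times the coefficient of frequency k is O(H log q), with
    H = (2q + 1)/V; the weaker bound H sqrt(q) is enough here. *)
Lemma box_trig_lip (e : int) q V u v :
  (e == 1) || (e == -1) -> (0 < V)%N ->
  cabs (box_trig e q V u - box_trig e q V v) <=
    16 * (q.*2.+1%:R / V%:R) * Num.sqrt q%:R * `|u - v|.
Proof.
move=> e1 V0; rewrite /box_trig -sumrB.
apply: le_trans (cabs_sum _ _ _) _.
have H0 : 0 <= q.*2.+1%:R / V%:R :> R by rewrite divr_ge0.
set H := q.*2.+1%:R / V%:R in H0 *.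
apply: (@le_trans _ _ (\sum_(1 <= k < q.+1) (8 * H * `|u - v|) * (Num.sqrt k%:R)^-1)).
  apply: ler_sum_nat => k kq.
  have -> : forall c c' x y x' y' : R[i],
     c * x + c' * x' - (c * y + c' * y') = c * (x - y) + c' * (x' - y').
    by move=> *; ring.
  have k0 : 0 < k%:R :> R by rewrite ltr0n; lia.
  have B t t' : `|t - t'| = k%:R * `|u - v| -> cabs (expi t - expi t') <= 8 * (k%:R * `|u - v|).
    by move=> <-; apply: cabs_expiB.
  have B1 : cabs (expi (k%:R * u) - expi (k%:R * v)) <= 8 * (k%:R * `|u - v|).
    by apply: B; rewrite -mulrBr normrM gtr0_norm.
  have B2 : cabs (expi (- (k%:R * u)) - expi (- (k%:R * v))) <= 8 * (k%:R * `|u - v|).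
    by apply: B; rewrite -opprD normrN -mulrBr normrM gtr0_norm.
  have C1 : cabs (box_coef R e q.*2.+1 V k) <= freq_weight H k / 2.
    by apply: box_coef_bound => //; lia.
  have C2 : cabs (box_coef R e q.*2.+1 V (q.*2.+1 - k)%N) <= freq_weight H k / 2.
    by apply: box_coef_bound => //; lia.
  apply: le_trans (cabsD _ _) _; rewrite [cabs (box_coef _ _ _ _ k * _)]cabsM.
  rewrite [cabs (box_coef _ _ _ _ (_ - _) * _)]cabsM.
  apply: le_trans (lerD (ler_pM (cabs_ge0 _) (cabs_ge0 _) C1 B1)
                        (ler_pM (cabs_ge0 _) (cabs_ge0 _) C2 B2)) _.
  rewrite -mulrDl -splitr.
  have W : freq_weight H k * k%:R <= H * (Num.sqrt k%:R)^-1.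
    apply: (@le_trans _ _ (H / k%:R ^+ 2 * k%:R)).
      by apply: ler_wpM2r; [exact: ltW | rewrite /freq_weight ge_min lexx orbT].
    have -> : H / k%:R ^+ 2 * k%:R = H * k%:R^-1 by field; rewrite gt_eqF.
    apply: ler_wpM2l => //; rewrite lef_pV2 ?posrE ?sqrtr_gt0//.
    have k1 : 1 <= k%:R :> R by rewrite ler1n; lia.
    have s1 : 1 <= Num.sqrt k%:R :> R by rewrite -[X in X <= _]sqrtr1 ler_wsqrtr.
    by have := ler_peMr (sqrtr_ge0 (k%:R : R)) s1; rewrite -expr2 sqr_sqrtr// ltW.
  have -> : freq_weight H k * (8 * (k%:R * `|u - v|)) = (freq_weight H k * k%:R) * (8 * `|u - v|).
    by ring.
  have -> : 8 * H * `|u - v| / Num.sqrt k%:R = (H * (Num.sqrt k%:R)^-1) * (8 * `|u - v|).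
    by ring.
  by apply: ler_wpM2r => //; rewrite mulr_ge0.
rewrite -big_distrr /=.
have -> : 16 * H * Num.sqrt q%:R * `|u - v| = 8 * H * `|u - v| * (2 * Num.sqrt q%:R) by ring.
by apply: ler_wpM2l; [rewrite !mulr_ge0 | apply: sum_inv_sqrt].
Qed.

(** [box_average] at the grid point g/Q next to u, and the Lipschitz bound to move
    from g/Q to u. *)
Lemma box_trig_close (e : int) q V (g : int) u : let Q := q.*2.+1 in
  (e == 1) || (e == -1) -> (0 < V)%N -> `|u - g%:~R / Q%:R| <= Q%:R^-1 ->
  `|V%:R^-1 * (\sum_(0 <= r < V) psi ((g + e * r%:Z)%:~R / Q%:R))
      - complex.Re (box_trig e q V u)| <= 16 / V%:R * Num.sqrt q%:R + Q%:R^-1.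
Proof.
move=> Q e1 V0 ug; have Q0 : 0 < Q%:R :> R by rewrite ltr0n.
set A := V%:R^-1 * _.
have E : (A + (2 * Q%:R)^-1)%:C = box_trig e q V (g%:~R / Q%:R) by exact: box_average.
have := box_trig_lip q u (g%:~R / Q%:R) e1 V0; rewrite -E.
have := Re_le_cabs (box_trig e q V u - (A + (2 * Q%:R)^-1)%:C).
case: (box_trig e q V u) => x y; rewrite /= => h1 h2.
have h3 : 16 * (Q%:R / V%:R) * Num.sqrt q%:R * `|u - g%:~R / Q%:R|
    <= 16 / V%:R * Num.sqrt q%:R.
  have -> : 16 / V%:R * Num.sqrt q%:R = 16 * (Q%:R / V%:R) * Num.sqrt q%:R * Q%:R^-1 :> R.
    by field; rewrite !gt_eqF// ltr0n.
  by apply: ler_wpM2l => //; rewrite !mulr_ge0 ?invr_ge0 ?sqrtr_ge0.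
have := le_trans h1 (le_trans h2 h3).
rewrite ler_norml => /andP[h4 h5].
have Qi : 0 < Q%:R^-1 :> R by rewrite invr_gt0.
have E2 : (2 * Q%:R)^-1 = Q%:R^-1 / 2 :> R by field; rewrite gt_eqF.
move: h4 h5; rewrite E2 => h4 h5.
by rewrite ler_norml; apply/andP; split; lra.
Qed.

(** psi(u) lies between its averages over the intervals of length 1/H to the right
    and to the left of u, up to 1/H. These averages are trigonometric polynomials,
    and averaging damps the coefficients enough to avoid the logarithm that a
    truncation of the Fourier series would cost. The grid has H^4 points for the
    Lipschitz error H sqrt(Q) / Q to be O(1/H) too, and H is odd for Q to be odd. *)
Lemma psi_sum_bound m : exists q, forall (u : nat -> R) (a b : nat), (a <= b)%N ->
  `|\sum_(a <= n < b) psi (u n)| <= (b - a)%:R * (18 / m.*2.+1%:R)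
     + \sum_(1 <= k < q.+1) freq_weight m.*2.+1%:R k
                              * cabs (\sum_(a <= n < b) expi (k%:R * u n)).
Proof.
pose H := m.*2.+1; pose V := (H ^ 3)%N; pose q := (H ^ 4)./2; pose Q := q.*2.+1.
exists q => u a b ab; rewrite -/H.
have EQ : Q = (H ^ 4)%N.
  have oddH : odd H by rewrite /H /= odd_double.
  by have := odd_double_half (H ^ 4); rewrite oddX oddH orbT add1n.
have H0 : 0 < H%:R :> R by rewrite ltr0n.
have V0 : (0 < V)%N by rewrite expn_gt0.
have Q0 : 0 < Q%:R :> R by rewrite ltr0n.
have Vr0 : 0 < V%:R :> R by rewrite ltr0n.
have EV : V%:R = H%:R ^+ 3 :> R by rewrite /V natrX.
have EQr : Q%:R = H%:R ^+ 4 :> R by rewrite EQ natrX.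
have EH : Q%:R / V%:R = H%:R :> R by rewrite EQr EV; field; rewrite gt_eqF.
have H1 : 1 <= H%:R :> R by rewrite ler1n.
have QH : Q%:R^-1 <= H%:R^-1 :> R.
  by rewrite lef_pV2 ?posrE// EQr exprS ler_peMr ?(ltW H0)// exprn_ege1.
have Err : 16 / V%:R * Num.sqrt q%:R + Q%:R^-1 <= 17 / H%:R :> R.
  have Hq : Num.sqrt q%:R <= H%:R ^+ 2 :> R.
    rewrite -[H%:R ^+ 2]ger0_norm ?exprn_ge0 ?ler0n// -sqrtr_sqr ler_wsqrtr//.
    by rewrite -exprM -natrX -EQ ler_nat /Q; lia.
  have : 16 / V%:R * Num.sqrt q%:R <= 16 / V%:R * H%:R ^+ 2 :> R.
    by apply: ler_wpM2l => //; rewrite divr_ge0.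
  have -> : 16 / V%:R * H%:R ^+ 2 = 16 / H%:R :> R by rewrite EV; field; rewrite gt_eqF.
  lra.
have VQ : V%:R / Q%:R = H%:R^-1 :> R by rewrite -EH invf_div.
pose g n := Num.floor (Q%:R * u n).
have gn n : (g n)%:~R / Q%:R <= u n < (g n + 1)%:~R / Q%:R.
  have /andP[h1 h2] := floor_itv (Q%:R * u n).
  by rewrite ler_pdivrMr// ltr_pdivlMr// mulrC h1.
have avg_const (x : R) : x = V%:R^-1 * (\sum_(0 <= r < V) x).
  by rewrite sumr_const_nat subn0 -[X in _ * X]mulr_natl mulrA mulVf ?mul1r// gt_eqF.
(* The points g - r, with r < V, cover the interval of length 1/H before u. *)
have up n : psi (u n) <= complex.Re (box_trig (-1) q V (u n)) + 18 / H%:R.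
  have /andP[g1 g2] := gn n; rewrite intrD mulrDl mul1r in g2.
  have ug : `|u n - (g n)%:~R / Q%:R| <= Q%:R^-1 by rewrite ger0_norm; lra.
  have := @box_trig_close (-1) q V (g n) (u n) isT V0 ug.
  rewrite ler_norml => /andP[_ h].
  suff : psi (u n) <= V%:R^-1 * \sum_(0 <= r < V) psi ((g n + -1 * r%:Z)%:~R / Q%:R) + H%:R^-1.
    by move: h Err; rewrite -/Q; lra.
  rewrite [X in _ <= _ + X](avg_const H%:R^-1) -mulrDr [leLHS]avg_const.
  apply: ler_wpM2l; first by rewrite invr_ge0.
  rewrite -big_split /=; apply: ler_sum_nat => r rV.
  have r1 : r%:R + 1 <= V%:R :> R by rewrite natr1 ler_nat; case/andP: rV.
  have ri0 : 0 <= r%:R / Q%:R :> R by rewrite divr_ge0.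
  have Er : (g n + -1 * r%:Z)%:~R / Q%:R = (g n)%:~R / Q%:R - r%:R / Q%:R :> R.
    by rewrite mulN1r intrD mulrDl rmorphN mulNr.
  apply: le_trans (@psi_lip _ ((g n + -1 * r%:Z)%:~R / Q%:R) _ _) _; rewrite Er; first lra.
  rewrite lerD2l.
  have : (r%:R + 1) / Q%:R <= V%:R / Q%:R :> R by rewrite ler_pM2r ?invr_gt0.
  rewrite VQ mulrDl mul1r; lra.
(* On the other side, g + 1 is the first grid point beyond u. *)
have lo n : complex.Re (box_trig 1 q V (u n)) - 18 / H%:R <= psi (u n).
  have /andP[g1 g2] := gn n.
  have ug : `|u n - (g n + 1)%:~R / Q%:R| <= Q%:R^-1.
    rewrite distrC ger0_norm; last by lra.
    by rewrite intrD mulrDl mul1r; lra.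
  have := @box_trig_close 1 q V (g n + 1) (u n) isT V0 ug.
  rewrite ler_norml => /andP[h _].
  suff : V%:R^-1 * \sum_(0 <= r < V) psi ((g n + 1 + 1 * r%:Z)%:~R / Q%:R) - H%:R^-1 <= psi (u n).
    by move: h Err; rewrite -/Q; lra.
  rewrite lerBlDr [X in _ <= _ + X](avg_const H%:R^-1) [X in _ <= X + _]avg_const -mulrDr.
  apply: ler_wpM2l; first by rewrite invr_ge0.
  rewrite -big_split /=; apply: ler_sum_nat => r rV.
  have r1 : r%:R + 1 <= V%:R :> R by rewrite natr1 ler_nat; case/andP: rV.
  have ri0 : 0 <= r%:R / Q%:R :> R by rewrite divr_ge0.
  have Er : (g n + 1 + 1 * r%:Z)%:~R / Q%:R = (g n + 1)%:~R / Q%:R + r%:R / Q%:R :> R.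
    by rewrite mul1r intrD mulrDl.
  apply: le_trans (@psi_lip _ (u n) _ _) _; rewrite Er; first lra.
  rewrite lerD2l.
  have : (r%:R + 1) / Q%:R <= V%:R / Q%:R :> R by rewrite ler_pM2r ?invr_gt0.
  rewrite VQ intrD !mulrDl mul1r; lra.
have ReS (e : int) : \sum_(a <= n < b) complex.Re (box_trig e q V (u n)) =
   complex.Re (\sum_(a <= n < b) box_trig e q V (u n)).
  by symmetry; apply: (big_morph (@complex.Re R)) => // -[? ?] [? ?].
have Sb (e : int) : (e == 1) || (e == -1) ->
   `|complex.Re (\sum_(a <= n < b) box_trig e q V (u n))| <=
    \sum_(1 <= k < q.+1) freq_weight H%:R k * cabs (\sum_(a <= n < b) expi (k%:R * u n)).
  by move=> e1; apply: le_trans (Re_le_cabs _) _; have := box_trig_sum q u a b e1 V0; rewrite EH.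
have Up : \sum_(a <= n < b) psi (u n) <=
    complex.Re (\sum_(a <= n < b) box_trig (-1) q V (u n)) + (b - a)%:R * (18 / H%:R).
  rewrite mulr_natl -sumr_const_nat -ReS -big_split /=.
  by apply: ler_sum => n _.
have Lo : complex.Re (\sum_(a <= n < b) box_trig 1 q V (u n)) - (b - a)%:R * (18 / H%:R)
    <= \sum_(a <= n < b) psi (u n).
  rewrite mulr_natl -sumr_const_nat -ReS -sumrB.
  by apply: ler_sum => n _.
have := Sb 1 isT; have := Sb (-1) isT; rewrite !ler_norml => /andP[_ h1] /andP[h2 _].
by apply/andP; split; lra.
Qed.

End SawtoothSums.

(** * Exponential sums along a hyperbola *)

Section Hyperbola.
Variable R : realType.
Implicit Types (x y s Y be ga : R) (q H h k n j m P : nat).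

Lemma sum_inv_3half H n : (0 < H)%N ->
  \sum_(H.+1 <= k < n) (k%:R * Num.sqrt k%:R)^-1 <= 2 / Num.sqrt H%:R :> R.
Proof.
move=> H0.
have sH : 0 < Num.sqrt H%:R :> R by rewrite sqrtr_gt0 ltr0n.
have [nH|nH] := leqP n H.+1; first by rewrite big_geq// divr_ge0// ltW.
suff claim i : \sum_(H.+1 <= k < H.+1 + i) (k%:R * Num.sqrt k%:R)^-1
    <= 2 / Num.sqrt H%:R - 2 / Num.sqrt (H + i)%:R :> R.
  have := claim (n - H.+1)%N; rewrite subnKC; last by lia.
  by move/le_trans; apply; rewrite gerBl divr_ge0 ?sqrtr_ge0.
elim: i => [|i IH]; first by rewrite !addn0 big_geq// subrr.
rewrite addnS big_nat_recr; last by lia.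
apply: le_trans (lerD IH (lexx _)) _.
rewrite -addrA lerD2l !(addSn, addnS); move: (H + i)%N (leq_addr i H) => l Hl.
have a0 : 0 < Num.sqrt l%:R :> R by rewrite sqrtr_gt0 ltr0n; lia.
have b0 : 0 < Num.sqrt l.+1%:R :> R by rewrite sqrtr_gt0 ltr0n.
have E : Num.sqrt l.+1%:R ^+ 2 = Num.sqrt l%:R ^+ 2 + 1 :> R.
  by rewrite !sqr_sqrtr ?ler0n// natr1.
have -> : l.+1%:R = Num.sqrt l.+1%:R ^+ 2 :> R by rewrite sqr_sqrtr ?ler0n.
rewrite sqrtr_sqr (gtr0_norm b0).
move: (Num.sqrt l.+1%:R) (Num.sqrt l%:R) b0 a0 E => b a b0 a0 E.
have ab : a <= b by rewrite -(@ler_pXn2r _ 2) ?nnegrE ?(ltW b0) ?(ltW a0)// E lerDl.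
rewrite -subr_le0.
have -> : - (2 / a) + (b ^+ 2 * b)^-1 - - (2 / b) =
    (a - 2 * b ^+ 2 * (b - a)) / (a * b ^+ 3).
  by field; rewrite !gt_eqF.
apply: mulr_le0_ge0; last by rewrite invr_ge0 mulr_ge0 ?exprn_ge0 ?ltW.
have : (b - a) * (b + a) = 1 by rewrite -subr_sqr E addrC addKr.
have : 0 <= b - a by lra.
move: (b - a) => c; nra.
Qed.

(** Both ranges k <= H and k > H contribute O(sqrt H): there is no logarithm. *)
Lemma sum_weight_sqrt H q : (0 < H)%N ->
  \sum_(1 <= k < q.+1) freq_weight H%:R k * Num.sqrt k%:R <= 4 * Num.sqrt H%:R :> R.
Proof.
move=> H0; have sH : 0 < Num.sqrt H%:R :> R by rewrite sqrtr_gt0 ltr0n.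
have sq k : (0 < k)%N -> k%:R = Num.sqrt k%:R ^+ 2 :> R by rewrite sqr_sqrtr ?ler0n.
have W1 n : (n <= H.+1)%N ->
   \sum_(1 <= k < n) freq_weight H%:R k * Num.sqrt k%:R <= 2 * Num.sqrt H%:R :> R.
  move=> nH; apply: le_trans (_ : \sum_(1 <= k < n) (Num.sqrt k%:R)^-1 <= _).
    apply: ler_sum_nat => k kn; have k0 : (0 < k)%N by lia.
    have s0 : 0 < Num.sqrt k%:R :> R by rewrite sqrtr_gt0 ltr0n.
    apply: (@le_trans _ _ (k%:R^-1 * Num.sqrt k%:R)).
      by rewrite ler_pM2r// /freq_weight ge_min lexx.
    by rewrite [X in X^-1 * _](sq k k0) expr2 invfM -mulrA mulVf ?mulr1// gt_eqF.
  case: n nH => [|n] nH; first by rewrite big_geq// mulr_ge0// ltW.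
  apply: le_trans (sum_inv_sqrt _ _) _.
  by rewrite ler_wpM2l// ler_wsqrtr// ler_nat; lia.
have [qH|qH] := leqP q H.
  by apply: le_trans (W1 _ _) _; [lia | lra].
rewrite (@big_cat_nat _ _ _ H.+1)/=; [|lia|lia].
apply: le_trans (lerD (W1 _ (leqnn _)) (_ : _ <= 2 * Num.sqrt H%:R)) _; last by lra.
apply: (@le_trans _ _ (\sum_(H.+1 <= k < q.+1) H%:R * (k%:R * Num.sqrt k%:R)^-1)).
  apply: ler_sum_nat => k kn; have k0 : (0 < k)%N by lia.
  have s0 : 0 < Num.sqrt k%:R :> R by rewrite sqrtr_gt0 ltr0n.
  apply: (@le_trans _ _ (H%:R / k%:R ^+ 2 * Num.sqrt k%:R)).
    by rewrite ler_pM2r// /freq_weight ge_min lexx orbT.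
  move: (Num.sqrt k%:R) s0 (sq k k0) => s s0 ->.
  by rewrite le_eqVlt; apply/orP; left; apply/eqP; field; rewrite gt_eqF.
rewrite -big_distrr /=.
apply: le_trans (ler_wpM2l _ (sum_inv_3half _ H0)) _ => //.
move: (Num.sqrt H%:R) sH (sq H H0) => s s0 ->.
by rewrite le_eqVlt; apply/orP; left; apply/eqP; field; rewrite gt_eqF.
Qed.

Lemma sum_weight_invsqrt H q :
  \sum_(1 <= k < q.+1) freq_weight H%:R k / Num.sqrt k%:R <= 3 :> R.
Proof.
case: q => [|q]; first by rewrite big_geq.
rewrite big_ltn// sqrtr1 divr1.
have -> : 3 = 1 + 2 / Num.sqrt 1%:R :> R by rewrite sqrtr1; lra.
apply: lerD; first by rewrite /freq_weight ge_min invr1 lexx.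
apply: le_trans (sum_inv_3half q.+2 (leqnn 1)).
apply: ler_sum_nat => k kn; rewrite invfM ler_wpM2r ?invr_ge0 ?sqrtr_ge0//.
by rewrite /freq_weight ge_min lexx.
Qed.

Definition hyp y be n : R := y / (n%:R + be).

(** On the block from P to 2P the function h y / n has second differences of size
    h y / P^3. The parameter s is such that y = P^3 s^6, so that all the powers of
    y and P that occur are integral powers of P and s. If h s^6 >= 1 the trivial
    bound P is already good enough. *)
Lemma hyp_expsum s be ga (h P b : nat) : 0 < s <= 1 -> 0 <= be <= 1 ->
  (0 < P)%N -> (P <= b <= P.*2)%N -> (0 < h)%N ->
  cabs (\sum_(P <= n < b) expi (h%:R * (hyp (P%:R ^+ 3 * s ^+ 6) be n - ga))) <=
    72 * (P%:R * s ^+ 3 * Num.sqrt h%:R + s ^- 3 / Num.sqrt h%:R).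
Proof.
move=> /andP[s0 s1] /andP[be0 be1] P0 Pb h0.
have Pr0 : 0 < P%:R :> R by rewrite ltr0n.
have hr0 : 0 < h%:R :> R by rewrite ltr0n.
have t0 : 0 < Num.sqrt h%:R :> R by rewrite sqrtr_gt0.
have Et : h%:R = Num.sqrt h%:R ^+ 2 :> R by rewrite sqr_sqrtr ?ltW.
set t := Num.sqrt h%:R in t0 Et *.
have s30 : 0 < s ^+ 3 by rewrite exprn_gt0.
have [big|small] := leP 1 (t * s ^+ 3).
  apply: le_trans (cabs_sum_expi _ _ _) _.
  apply: (@le_trans _ _ P%:R); first by rewrite ler_nat; lia.
  have h1 : P%:R <= P%:R * s ^+ 3 * t by rewrite -mulrA ler_peMr ?(ltW Pr0)// mulrC.
  have h2 : 0 <= s ^- 3 / t by rewrite divr_ge0 ?invr_ge0 ?(ltW s30)// ltW.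
  by rewrite mulrDr; nra.
pose f n := h%:R * (hyp (P%:R ^+ 3 * s ^+ 6) be n - ga).
have D1 n : (0 < n)%N -> f n.+1 - f n =
     - (h%:R * (P%:R ^+ 3 * s ^+ 6)) / ((n%:R + be) * (n%:R + be + 1)).
  move=> n0; have nr0 : 0 < n%:R :> R by rewrite ltr0n.
  by rewrite /f /hyp -natr1; field; apply/andP; split; rewrite gt_eqF//; lra.
(* A perfect square below the true lower bound 2 h s^6 / 27. *)
set l := (t * s ^+ 3 / 6) ^+ 2.
have ts0 : 0 < t * s ^+ 3 by rewrite mulr_gt0.
have l01 : 0 < l <= 1.
  rewrite /l exprn_gt0 ?divr_gt0//= expr_le1// ?divr_ge0 ?ltW//.
  by rewrite ltr_pdivrMr//; lra.
pose r := h%:R * P%:R * s ^+ 6.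
have r0 : 0 <= r by rewrite /r !mulr_ge0// ?exprn_ge0// ltW.
have hy0 : 0 < h%:R * (P%:R ^+ 3 * s ^+ 6) by rewrite !mulr_gt0 ?exprn_gt0.
have := @second_difference_test R l r f P b l01 r0.
have -> : Num.sqrt l = t * s ^+ 3 / 6.
  by rewrite /l sqrtr_sqr gtr0_norm// divr_gt0.
move=> SD; apply: le_trans (SD _ _ _) _; first by case/andP: Pb.
- move=> n Pn nb; have n0 : (0 < n)%N by apply: leq_trans P0 Pn.
  rewrite !D1//.
  have nr : 0 < n%:R + be by rewrite ltr_wpDr// ltr0n.
  have nP : n%:R + 2 <= 2 * P%:R :> R.
    by rewrite -natrD -natrM ler_nat mul2n addn2 (leq_trans nb)//; case/andP: Pb.
  have P1 : 1 <= P%:R :> R by rewrite ler1n.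
  rewrite -natr1; set z := n%:R + be in nr *.
  have -> : n%:R + 1 + be = z + 1 by rewrite /z; ring.
  have zP : z + 2 <= 3 * P%:R by rewrite /z; lra.
  set Y := h%:R * _ in hy0 *.
  rewrite -subr_ge0.
  have -> : - Y / ((z + 1) * (z + 1 + 1)) - (- Y / (z * (z + 1)) + l) =
     2 * Y / (z * (z + 1) * (z + 2)) - l.
    by field; rewrite !gt_eqF//; lra.
  rewrite subr_ge0.
  have B : z * (z + 1) * (z + 2) <= (3 * P%:R) ^+ 3.
    rewrite !exprS expr0 mulr1 mulrA; apply: ler_pM; rewrite ?mulr_ge0//; try lra.
    by apply: ler_pM; lra.
  have z3 : 0 < z * (z + 1) * (z + 2) by rewrite !mulr_gt0//; lra.
  apply: (@le_trans _ _ (2 * Y / (3 * P%:R) ^+ 3)).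
    have -> : 2 * Y / (3 * P%:R) ^+ 3 = l * (72 / 27).
      by rewrite /Y /l Et; field; rewrite gt_eqF.
    by rewrite ler_peMr ?(ltW (andP l01).1)//; lra.
  apply: ler_wpM2l; first by rewrite mulr_ge0// ltW.
  by rewrite lef_pV2 ?posrE// exprn_gt0 ?mulr_gt0.
- move=> n nPb; have n0 : (0 < n)%N by case/andP: nPb => /(leq_trans P0).
  rewrite !D1//.
  have nr : 0 < n%:R + be by rewrite ltr_wpDr// ltr0n.
  have Prb : 0 < P%:R + be by rewrite ltr_wpDr// ltr0n.
  set Y := h%:R * _ in hy0 *.
  apply: (@le_trans _ _ 0).
    by rewrite mulNr oppr_le0 divr_ge0 ?mulr_ge0//; lra.
  rewrite mulNr addrC subr_ge0.
  have -> : r = Y / P%:R ^+ 2 by rewrite /r /Y; field; rewrite gt_eqF.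
  apply: ler_wpM2l; first exact: ltW.
  rewrite lef_pV2 ?posrE ?exprn_gt0 ?mulr_gt0//; last by lra.
  by rewrite expr2; apply: ler_pM; lra.
have -> : 6 * (r + 2) / (t * s ^+ 3 / 6) =
    72 * (P%:R * s ^+ 3 * t + s ^- 3 / t) - 36 * (P%:R * s ^+ 3 * t).
  by rewrite /r Et; field; rewrite !gt_eqF.
by rewrite gerBl !mulr_ge0// ltW.
Qed.

End Hyperbola.

(** * Sums of the sawtooth function along a hyperbola *)

Section HyperbolaSums.
Variable R : realType.
Implicit Types (x y s Y be ga : R) (q H h k n j m P : nat).

(** With y = P^3 s^6 the bound is O(y^(1/3) + (P^3/y)^(1/2)): the averaging length
    1/H of [psi_sum_bound] is taken of size s^2, which equates the averaging error
    P/H with the contribution P s^3 sqrt(H) of the exponential sums. *)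
Lemma hyp_block s be ga (P b : nat) : 0 < s <= 1 -> 0 <= be <= 1 ->
  (0 < P)%N -> (P <= b <= P.*2)%N ->
  `|\sum_(P <= n < b) psi (hyp (P%:R ^+ 3 * s ^+ 6) be n - ga)| <=
    1000 * (P%:R * s ^+ 2 + s ^- 3).
Proof.
move=> s01 be01 P0 Pb; have /andP[s0 s1] := s01.
have Pr0 : 0 < P%:R :> R by rewrite ltr0n.
have bP : (b - P <= P)%N by rewrite leq_subLR addnn; case/andP: Pb.
have Pb1 : (P <= b)%N by case/andP: Pb.
pose m := Num.truncn (s ^- 2).
have s2 : 0 < s ^- 2 by rewrite invr_gt0 exprn_gt0.
have /andP[m1 m2] := truncn_itv (ltW s2).
have [q Hq] := psi_sum_bound R m.
apply: le_trans (Hq _ _ _ Pb1) _.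
set H := m.*2.+1.
have H0 : (0 < H)%N by [].
have Hr0 : 0 < H%:R :> R by rewrite ltr0n.
have Hlo : s ^- 2 <= H%:R.
  apply: le_trans (ltW m2) _; rewrite ler_nat /H ltnS -addnn; exact: leq_addr.
have Hhi : H%:R <= 3 * s ^- 2.
  have : 1 <= s ^- 2.
    by rewrite invr_ge1 ?unitfE ?expf_neq0 ?gt_eqF ?posrE ?exprn_gt0// expr_le1// ltW.
  have m3 : m%:R <= s ^- 2 by [].
  rewrite /H -natr1 -muln2 natrM; lra.
have sHhi : Num.sqrt H%:R <= 2 / s.
  have -> : 2 / s = Num.sqrt ((2 / s) ^+ 2) by rewrite sqrtr_sqr gtr0_norm// divr_gt0.
  rewrite ler_wsqrtr//; apply: le_trans Hhi _.
  by rewrite expr_div_n ler_wpM2r ?(ltW s2)//; lra.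
have A1 : (b - P)%:R * (18 / H%:R) <= 18 * (P%:R * s ^+ 2).
  have -> : 18 * (P%:R * s ^+ 2) = P%:R * (18 * s ^+ 2) by ring.
  apply: ler_pM; rewrite ?ler_nat ?divr_ge0//.
  apply: ler_wpM2l => //; rewrite -(invrK (s ^+ 2)) lef_pV2 ?posrE//.
apply: le_trans (lerD A1 (_ : _ <=
  72 * (P%:R * s ^+ 3 * (4 * Num.sqrt H%:R) + s ^- 3 * 3))) _; last first.
  have h1 : P%:R * s ^+ 3 * (4 * Num.sqrt H%:R) <= P%:R * s ^+ 3 * (4 * (2 / s)).
    apply: ler_wpM2l; first by rewrite mulr_ge0 ?exprn_ge0// ltW.
    by rewrite ler_pM2l.
  have h2 : P%:R * s ^+ 3 * (4 * (2 / s)) = 8 * (P%:R * s ^+ 2) by field; rewrite gt_eqF.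
  have h3 : 0 <= P%:R * s ^+ 2 by rewrite mulr_ge0 ?exprn_ge0 ?ltW.
  have h4 : 0 <= s ^- 3 by rewrite invr_ge0 exprn_ge0// ltW.
  move: h1 h2 h3 h4; set u := P%:R * s ^+ 3 * _; set v := P%:R * s ^+ 3 * _.
  by set w := P%:R * s ^+ 2; set z := s ^- 3; lra.
apply: (@le_trans _ _ (\sum_(1 <= k < q.+1)
    (72 * (P%:R * s ^+ 3) * (freq_weight H%:R k * Num.sqrt k%:R)
     + 72 * s ^- 3 * (freq_weight H%:R k / Num.sqrt k%:R)))).
  apply: ler_sum_nat => k /andP[k0 _].
  have -> : 72 * (P%:R * s ^+ 3) * (freq_weight H%:R k * Num.sqrt k%:R)
     + 72 * s ^- 3 * (freq_weight H%:R k / Num.sqrt k%:R) =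
     freq_weight H%:R k * (72 * (P%:R * s ^+ 3 * Num.sqrt k%:R + s ^- 3 / Num.sqrt k%:R)).
    by ring.
  apply: ler_wpM2l; first by rewrite freq_weight_ge0.
  exact: hyp_expsum.
rewrite big_split /= -!big_distrr /=.
have c1 : 0 <= 72 * (P%:R * s ^+ 3) by rewrite !mulr_ge0 ?exprn_ge0 ?ltW.
have c2 : 0 <= 72 * s ^- 3 by rewrite mulr_ge0 ?invr_ge0 ?exprn_ge0 ?ltW.
apply: le_trans (lerD (ler_wpM2l c1 (sum_weight_sqrt R q H0))
                      (ler_wpM2l c2 (sum_weight_invsqrt R H q))) _.
by rewrite le_eqVlt; apply/orP; left; apply/eqP; ring.
Qed.

(** With y = Y^3, each of the j dyadic blocks contributes O(Y): below 2Y the trivial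
    bound does, and up to sqrt(y) the second term of [hyp_block] is at most
    y^(1/4) <= Y. *)
Lemma hyp_sum_dyadic Y be ga j n : 1 <= Y -> 0 <= be <= 1 -> (n <= 2 ^ j)%N ->
  (n.-1)%:R ^+ 2 <= Y ^+ 3 ->
  `|\sum_(1 <= k < n) psi (hyp (Y ^+ 3) be k - ga)| <= j%:R * (2000 * Y).
Proof.
move=> Y1 be01; have Y0 : 0 < Y by lra.
elim: j n => [|j IH] n nj nY.
  by rewrite big_geq// normr0 mul0r.
have [n2Y|n2Y] := leP n%:R (2 * Y).
  apply: (@le_trans _ _ (\sum_(1 <= k < n) 2^-1)).
    apply: le_trans (ler_norm_sum _ _ _) _.
    by apply: ler_sum => k _; apply: psi_bound.
  rewrite sumr_const_nat -[2^-1 *+ _]mulr_natr.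
  apply: (@le_trans _ _ (2^-1 * n%:R)); first by rewrite ler_wpM2l ?invr_ge0// ler_nat leq_subr.
  have c0 : 0 <= 2000 * Y by lra.
  have : 0 <= j%:R * (2000 * Y) by exact: mulr_ge0.
  rewrite -natr1 mulrDl; lra.
pose P := uphalf n.
have n2 : (2 < n)%N by rewrite -(ltr_nat R); lra.
have Pn : (n <= P.*2)%N.
  by rewrite /P uphalf_half doubleD -{1}(odd_double_half n); case: odd.
have Pn1 : (P <= n.-1)%N.
  rewrite /P uphalf_half; have := odd_double_half n; move: n2; clear.
  by case: (odd n) => /=; lia.
have Pj : (P <= 2 ^ j)%N.
  rewrite /P leq_uphalf_double -mul2n -expnS//.
have P0 : (0 < P)%N by rewrite /P; case: (n) n2 => // -[].
have YP : Y < P%:R.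
  have : n%:R <= 2 * P%:R :> R by rewrite -natrM mul2n ler_nat.
  lra.
have Pr0 : 0 < P%:R :> R by rewrite ltr0n.
have Pn2 : (P <= n)%N by apply: leq_trans Pn1 (leq_pred n).
rewrite (@big_cat_nat _ _ _ P)/=; [|exact: P0|exact: Pn2].
apply: le_trans (ler_normD _ _) _.
rewrite -natr1 mulrDl mul1r; apply: lerD.
  apply: IH => //; apply: le_trans nY.
  by rewrite lerXn2r ?nnegrE// ler_nat; move: Pn2; clear; lia.
pose s := Num.sqrt (Y / P%:R).
have s2 : s ^+ 2 = Y / P%:R by rewrite sqr_sqrtr// divr_ge0// ltW.
have s0 : 0 < s by rewrite sqrtr_gt0 divr_gt0.
have s1 : s <= 1 by rewrite -sqrtr1 ler_wsqrtr// ler_pdivrMr// mul1r ltW.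
have E : Y ^+ 3 = P%:R ^+ 3 * s ^+ 6.
  by rewrite -[6%N]/(2 * 3)%N exprM s2 expr_div_n mulrC mulfVK// expf_neq0// gt_eqF.
rewrite E; apply: le_trans (hyp_block ga _ be01 P0 _) _.
- by rewrite s0.
- by rewrite Pn Pn2.
have -> : 2000 * Y = 1000 * (Y + Y) by ring.
apply: ler_wpM2l; first exact: ler0n.
apply: lerD; first by rewrite s2 mulrC mulfVK// gt_eqF.
rewrite -[leLHS]div1r ler_pdivrMr ?exprn_gt0//.
have E5 : (Y * s ^+ 3) ^+ 2 = Y ^+ 5 / P%:R ^+ 3.
  rewrite exprMn -exprM mulnC exprM s2 expr_div_n; field; rewrite gt_eqF//.
have Ys0 : 0 <= Y * s ^+ 3 by rewrite mulr_ge0 ?exprn_ge0 ?ltW.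
rewrite -(@ler_pXn2r _ 2) ?nnegrE// expr1n E5 ler_pdivlMr ?exprn_gt0// mul1r.
have PY : P%:R ^+ 2 <= Y ^+ 3.
  by apply: le_trans nY; rewrite lerXn2r ?nnegrE// ler_nat.
rewrite -(@ler_pXn2r _ 2) ?nnegrE ?exprn_ge0 ?(ltW Y0) ?(ltW Pr0)//.
have -> : (P%:R ^+ 3) ^+ 2 = (P%:R ^+ 2) ^+ 3 :> R by rewrite -!exprM.
apply: (@le_trans _ _ ((Y ^+ 3) ^+ 3)).
  by rewrite lerXn2r ?nnegrE ?exprn_ge0 ?(ltW Y0) ?(ltW Pr0).
by rewrite -!exprM; apply: ler_weXn2l.
Qed.

End HyperbolaSums.

(** * Counting the n for which d divides the integral part of x/n *)

Section Counting.
Variable R : realType.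
Implicit Types (x y u : R) (d k n m q j K N : nat).

(** Both sides say that n m <= x. *)
Lemma truncn_div_swap x n m : 0 <= x -> (0 < n)%N -> (0 < m)%N ->
  (n <= Num.truncn (x / m%:R))%N = (m <= Num.truncn (x / n%:R))%N.
Proof.
move=> x0 n0 m0; rewrite !truncn_ge_nat ?divr_ge0//.
by rewrite !ler_pdivlMr ?ltr0n// mulrC.
Qed.

Lemma sum_leq_nat (t X : nat) : (t <= X)%N ->
  \sum_(1 <= n < X.+1) (n <= t)%:R = t%:R :> R.
Proof.
move=> tX; rewrite (@big_cat_nat _ _ _ t.+1)//=.
rewrite [X in _ + X]big1_seq ?addr0; last first.
  by move=> n; rewrite mem_index_iota => /andP[_ /andP[tn _]]; rewrite leqNgt tn.
rewrite (eq_big_nat _ _ (F2 := fun=> 1)); last by move=> n /andP[_]; rewrite ltnS => ->.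
by rewrite sumr_const_nat subn1.
Qed.

Lemma count_eq x m : 0 <= x -> (0 < m)%N ->
  \sum_(1 <= n < (Num.truncn x).+1) (Num.truncn (x / n%:R) == m)%:R
  = (Num.truncn (x / m%:R))%:R - (Num.truncn (x / m.+1%:R))%:R :> R.
Proof.
move=> x0 m0.
have le_tr l : (0 < l)%N -> (Num.truncn (x / l%:R) <= Num.truncn x)%N.
  by move=> l0; apply: le_truncn; rewrite ler_pdivrMr ?ltr0n// ler_peMr// ler1n.
rewrite -(sum_leq_nat (le_tr m m0)) -(sum_leq_nat (le_tr m.+1 isT)) -sumrB.
apply: eq_big_nat => n /andP[n0 _].
rewrite (truncn_div_swap x0 n0 m0) (truncn_div_swap x0 n0 (ltn0Sn m)).
move: (Num.truncn _) => q; by case: (ltngtP q m) => h; rewrite ?subrr ?subr0 // ?(ltnW h).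
Qed.

(** The first step of the hyperbola method: the multiples of d up to K d are
    enumerated, the larger ones are left to be counted by the variable n. *)
Lemma dvdn_split d q K : (0 < d)%N -> (0 < q)%N ->
  (d %| q)%:R = \sum_(1 <= k < K.+1) (q == k * d)%:R
      + (d %| q)%:R * (K.+1 * d <= q)%:R :> R.
Proof.
move=> d0 q0; have [/dvdnP[j Ej]|ndq] := boolP (d %| q)%N; last first.
  rewrite mul0r addr0 big1// => k _.
  by case: eqP ndq => // ->; rewrite dvdn_mull.
have j0 : (0 < j)%N by move: q0; rewrite Ej muln_gt0 => /andP[].
rewrite Ej leq_pmul2r// mul1r.
under eq_bigr do rewrite eqn_pmul2r//.
have [jK|jK] := leqP K.+1 j.
  rewrite big1_seq ?add0r// => k; rewrite mem_index_iota => /andP[_ /andP[_ kK]].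
  by rewrite gtn_eqF// (leq_trans kK).
rewrite addr0 (@big_cat_nat _ _ _ j)//=; last exact: ltnW.
rewrite [X in X + _]big1_seq ?add0r; last first.
  by move=> k; rewrite mem_index_iota => /andP[_ /andP[_ kj]]; rewrite gtn_eqF.
rewrite big_ltn// eqxx big1_seq ?addr0// => k.
by rewrite mem_index_iota => /andP[_ /andP[jk _]]; rewrite ltn_eqF.
Qed.

Lemma truncn_psi u : 0 <= u -> (Num.truncn u)%:R = u - psi u - 2^-1.
Proof.
move=> u0; rewrite /psi truncn_floor u0 natr_absz ger0_norm ?floor_ge0//.
by ring.
Qed.

(** The left hand side is floor(u) - floor(u - 1/d), since d divides the integral
    part of u d exactly when u has fractional part less than 1/d. *)
Lemma dvdn_psi u d : (0 < d)%N -> 0 <= u ->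
  (d %| Num.truncn (u * d%:R))%:R = d%:R^-1 - psi u + psi (u - d%:R^-1) :> R.
Proof.
move=> d0 u0; have dr0 : 0 < d%:R :> R by rewrite ltr0n.
have /andP[] := truncn_itv (mulr_ge0 u0 (ltW dr0)).
set q := Num.truncn _; have Eq := divn_eq q d; have rd := ltn_pmod q d0.
rewrite /dvdn; move: (q %/ d)%N (q %% d)%N Eq rd => j r Eq rd.
rewrite Eq -natr1 natrD natrM => h1 h2.
have e1 : d%:R * d%:R^-1 = 1 :> R by rewrite divff// gt_eqF.
have i0 : 0 < d%:R^-1 :> R by rewrite invr_gt0.
have h1' : j%:R + r%:R * d%:R^-1 <= u.
  by rewrite -(ler_pM2r dr0) mulrDl divfK ?gt_eqF.
have h2' : u < j%:R + r%:R * d%:R^-1 + d%:R^-1.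
  by rewrite -(ltr_pM2r dr0) !mulrDl divfK ?mulVf ?gt_eqF.
have r1 : r%:R * d%:R^-1 + d%:R^-1 <= 1 :> R.
  have : (r%:R + 1) * d%:R^-1 <= d%:R * d%:R^-1 :> R.
    by rewrite ler_pM2r// natr1 ler_nat.
  by rewrite e1 mulrDl mul1r.
have r0 : 0 <= r%:R * d%:R^-1 :> R by rewrite mulr_ge0// ltW.
have F1 : Num.floor u = j%:Z by apply: floor_def; rewrite intrD -!pmulrn; lra.
rewrite /psi F1 -pmulrn.
have [r00|rp] := eqVneq r 0%N.
  rewrite r00 mul0r in h1' h2'.
  have -> : Num.floor (u - d%:R^-1) = j%:Z - 1.
    by apply: floor_def; rewrite subrK intrB -!pmulrn; move: r1; rewrite r00; lra.
  by rewrite intrB -pmulrn /=; ring.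
have rr : 1 * d%:R^-1 <= r%:R * d%:R^-1 :> R by rewrite ler_pM2r// ler1n lt0n.
have -> : Num.floor (u - d%:R^-1) = j%:Z.
  by apply: floor_def; rewrite intrD -!pmulrn; lra.
by rewrite -pmulrn /=; ring.
Qed.

Definition mult_count x d : R :=
  \sum_(1 <= n < (Num.truncn x).+1) (d %| Num.truncn (x / n%:R))%:R.

Definition mult_series d N : R :=
  \sum_(1 <= n < N) (d %| n)%:R / (n * n.+1)%:R.

Lemma sum_multiples (F : nat -> R) d N : (0 < d)%N ->
  \sum_(1 <= n < N) (d %| n)%:R * F n
   = \sum_(1 <= k < (N.-1 %/ d).+1) F (k * d)%N.
Proof.
move=> d0; case: N => [|N]; first by rewrite !big_geq// div0n.
elim: N => [|N IH]; first by rewrite !big_geq// div0n.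
rewrite big_nat_recr//= {}IH /=.
have [dN|ndN] := boolP (d %| N.+1)%N.
  rewrite mul1r (_ : F N.+1 = F (N.+1 %/ d * d)%N); last by rewrite divnK.
  have : (0 < N.+1 %/ d)%N.
    by rewrite divn_gt0// dvdn_leq.
  have -> : (N %/ d = (N.+1 %/ d).-1)%N.
    have := divnS N d0; rewrite dN => ->; by rewrite add1n.
  by move=> h; rewrite prednK// [RHS]big_nat_recr.
rewrite mul0r addr0; have := divnS N d0; rewrite (negPf ndN) add0n => ->.
by [].
Qed.

(** The hyperbola method, for pairs (n, k) with floor(x/n) = k d. For k <= K the n
    are counted by floor(x/(kd)) - floor(x/(kd+1)); for k > K one has n <= L, and
    [dvdn_psi] applies to each n. *)
Lemma count_decomp x d : 0 <= x -> (0 < d)%N -> forall K,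
  let y := x / d%:R in let L := Num.truncn (y / K.+1%:R) in
  mult_count x d = x * (\sum_(1 <= k < K.+1) ((k * d) * (k * d).+1)%:R^-1)
    + L%:R / d%:R
    - \sum_(1 <= k < K.+1) psi (hyp y 0 k - 0)
    + \sum_(1 <= k < K.+1) psi (hyp y d%:R^-1 k - 0)
    - \sum_(1 <= n < L.+1) psi (hyp y 0 n - 0)
    + \sum_(1 <= n < L.+1) psi (hyp y 0 n - d%:R^-1).
Proof.
move=> x0 d0 K y L; have dr0 : 0 < d%:R :> R by rewrite ltr0n.
have y0 : 0 <= y by rewrite divr_ge0.
have EL : L = Num.truncn (x / (K.+1 * d)%:R).
  by rewrite /L /y natrM invfM -mulrA (mulrC d%:R^-1).
have LX : (L <= Num.truncn x)%N.
  rewrite EL; apply: le_truncn; rewrite ler_pdivrMr ?ltr0n ?muln_gt0 ?d0//.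
  by rewrite ler_peMr// ler1n muln_gt0 d0.
have -> : mult_count x d =
   \sum_(1 <= k < K.+1) \sum_(1 <= n < (Num.truncn x).+1) (Num.truncn (x / n%:R) == k * d)%N%:R
   + \sum_(1 <= n < L.+1) (d %| Num.truncn (x / n%:R))%:R.
  rewrite exchange_big /= /mult_count.
  rewrite (eq_big_nat _ _ (F2 := fun n =>
     \sum_(1 <= k < K.+1) (Num.truncn (x / n%:R) == k * d)%N%:R
     + (d %| Num.truncn (x / n%:R))%:R * (n <= L)%:R)); last first.
    move=> n /andP[n0 nX].
    have q0 : (0 < Num.truncn (x / n%:R))%N.
      by rewrite -truncn_div_swap// divr1 -ltnS.
    rewrite {1}(dvdn_split K d0 q0) EL truncn_div_swap//.
    by rewrite muln_gt0 d0.
  rewrite big_split /=; congr (_ + _).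
  rewrite (@big_cat_nat _ _ _ L.+1)//=.
  rewrite [X in _ + X]big1_seq ?addr0; last first.
    move=> n; rewrite mem_index_iota => /andP[_ /andP[Ln _]].
    by rewrite leqNgt Ln mulr0.
  by apply: eq_big_nat => n /andP[_]; rewrite ltnS => ->; rewrite mulr1.
have -> : \sum_(1 <= k < K.+1) \sum_(1 <= n < (Num.truncn x).+1)
       (Num.truncn (x / n%:R) == k * d)%N%:R
  = \sum_(1 <= k < K.+1) (x * ((k * d) * (k * d).+1)%:R^-1
      - psi (hyp y 0 k - 0) + psi (hyp y d%:R^-1 k - 0)) :> R.
  apply: eq_big_nat => k /andP[k0 _]; have kr0 : 0 < k%:R :> R by rewrite ltr0n.
  rewrite count_eq ?muln_gt0 ?k0//.
  have -> : hyp y 0 k - 0 = x / (k * d)%:R.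
    by rewrite /hyp /y natrM; field; rewrite !gt_eqF.
  have kd0 : 0 < k%:R * d%:R :> R by rewrite mulr_gt0.
  have kd1 : 0 < k%:R * d%:R + 1 :> R by rewrite addr_gt0.
  have -> : hyp y d%:R^-1 k - 0 = x / (k * d).+1%:R.
    by rewrite /hyp /y -natr1 natrM; field; rewrite !gt_eqF.
  rewrite !truncn_psi ?divr_ge0// [(_ * _.+1)%:R]natrM -natr1 natrM.
  by field; rewrite !gt_eqF.
rewrite [X in _ + X = _](eq_big_nat _ _ (F2 := fun n => d%:R^-1 - psi (hyp y 0 n - 0)
     + psi (hyp y 0 n - d%:R^-1))); last first.
  move=> n /andP[n0 _]; have nr0 : 0 < n%:R :> R by rewrite ltr0n.
  have -> : x / n%:R = hyp y 0 n * d%:R by rewrite /hyp /y; field; rewrite !gt_eqF.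
  by rewrite dvdn_psi ?subr0// /hyp addr0 divr_ge0.
rewrite big_split big_split /= [in X in _ + X = _]big_split [in X in _ + X = _]big_split /=.
rewrite !sumrN -big_distrr /=.
have -> : \sum_(1 <= n < L.+1) d%:R^-1 = L%:R / d%:R :> R.
  by rewrite sumr_const_nat subn1 mulr_natl.
by ring.
Qed.

End Counting.

(** * The error term for one divisor *)

Section CountError.
Variable R : realType.
Implicit Types (x y u : R) (d k n m q j K M N : nat).

Definition mult_term d k : R := ((k * d) * (k * d).+1)%:R^-1.

Lemma mult_seriesE d N : (0 < d)%N ->
  mult_series R d N = \sum_(1 <= k < (N.-1 %/ d).+1) mult_term d k.
Proof. exact: sum_multiples. Qed.

(** k d (k d + 1) lies between (k d)^2 and k (k + 1) d^2; the latter telescopes. *)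
Lemma mult_term_bounds d k : (0 < d)%N -> (0 < k)%N ->
  (k%:R^-1 - k.+1%:R^-1) / d%:R ^+ 2 <= mult_term d k
  /\ mult_term d k <= (k%:R ^+ 2)^-1 / d%:R ^+ 2.
Proof.
move=> d0 k0; have [dr0 kr0] : 0 < d%:R :> R /\ 0 < k%:R :> R by rewrite !ltr0n.
have d1 : 1 <= d%:R :> R by rewrite ler1n.
have kd : 0 < k%:R * d%:R :> R by rewrite mulr_gt0.
rewrite /mult_term natrM -[(k * d).+1%:R]natr1 natrM; split.
  have -> : (k%:R^-1 - k.+1%:R^-1) / d%:R ^+ 2 =
     ((k%:R * d%:R) * ((k%:R + 1) * d%:R))^-1 :> R.
    by rewrite -natr1; field; rewrite !gt_eqF//; lra.
  rewrite lef_pV2 ?posrE ?mulr_gt0//; try lra.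
  by apply: ler_wpM2l; [exact: ltW | lra].
rewrite -invfM lef_pV2 ?posrE ?mulr_gt0 ?exprn_gt0//; last by lra.
Qed.

Lemma mult_tail_le d K M : (0 < d)%N -> (0 < K)%N -> (K <= M)%N ->
  \sum_(K.+1 <= k < M.+1) mult_term d k <= (K%:R^-1 - M%:R^-1) / d%:R ^+ 2.
Proof.
move=> d0 K0; elim: M => [|M IH]; first by rewrite leqNgt K0.
rewrite leq_eqVlt => /orP[/eqP <-|]; first by rewrite big_geq// subrr mul0r.
rewrite ltnS => KM; rewrite big_nat_recr//=; have M0 : (0 < M)%N by apply: leq_trans KM.
have [_ h] := mult_term_bounds d0 (ltn0Sn M).
apply: le_trans (lerD (IH KM) h) _; rewrite -mulrDl ler_wpM2r ?invr_ge0//.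
have mr0 : 0 < M%:R :> R by rewrite ltr0n.
suff : (M.+1%:R ^+ 2)^-1 <= M%:R^-1 - M.+1%:R^-1 :> R.
  by move: (_ ^- 2) (M.+1%:R^-1) (M%:R^-1) (K%:R^-1) => ? ? ? ?; lra.
have -> : M%:R^-1 - M.+1%:R^-1 = (M%:R * M.+1%:R)^-1 :> R.
  by rewrite -natr1; field; rewrite !gt_eqF//; lra.
rewrite lef_pV2 ?posrE ?mulr_gt0 ?exprn_gt0 ?ltr0n//.
by rewrite expr2 ler_pM2r ?ltr0n// ler_nat.
Qed.

Lemma mult_tail_ge d K M : (0 < d)%N -> (0 < K)%N -> (K <= M)%N ->
  (K.+1%:R^-1 - M.+1%:R^-1) / d%:R ^+ 2 <= \sum_(K.+1 <= k < M.+1) mult_term d k.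
Proof.
move=> d0 K0; elim: M => [|M IH]; first by rewrite leqNgt K0.
rewrite leq_eqVlt => /orP[/eqP <-|]; first by rewrite big_geq// subrr mul0r.
rewrite ltnS => KM; rewrite big_nat_recr//=.
have [h _] := mult_term_bounds d0 (ltn0Sn M).
apply: le_trans (lerD (IH KM) h); rewrite -mulrDl ler_wpM2r ?invr_ge0//.
by rewrite addrA subrK.
Qed.

Lemma mult_series_ge0 d N : 0 <= mult_series R d N.
Proof. by apply: sumr_ge0 => n _; rewrite divr_ge0. Qed.

Lemma mult_series_le d N : (0 < d)%N -> mult_series R d N <= 2 / d%:R ^+ 2.
Proof.
move=> d0; have dr0 : 0 < d%:R :> R by rewrite ltr0n.
have i0 : 0 <= (d%:R ^+ 2)^-1 :> R by rewrite invr_ge0 exprn_ge0.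
rewrite mult_seriesE//; case: (N.-1 %/ d)%N => [|M].
  by rewrite big_geq// divr_ge0// exprn_ge0.
rewrite big_ltn//; have [_] := mult_term_bounds d0 (ltn0Sn 0).
have := mult_tail_le d0 (leqnn 1) (ltn0Sn M).
rewrite expr1n invr1 mul1r => h1 h2.
have h3 : (1 - M.+1%:R^-1) / d%:R ^+ 2 <= (d%:R ^+ 2)^-1 :> R.
  by rewrite ler_piMl// gerBl invr_ge0.
by apply: le_trans (lerD h2 (le_trans h1 h3)) _; rewrite -mulr2n mulr_natl.
Qed.

Lemma ln2_ge_half : 2^-1 <= ln 2 :> R.
Proof.
have h : -1 < - 2^-1 :> R by lra.
have := le_ln1Dx h; have -> : 1 + - 2^-1 = 2^-1 :> R by lra.
by rewrite lnV ?posrE//; lra.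
Qed.

Lemma ln_ge1 x : 16 <= x -> 1 <= ln x.
Proof.
move=> x16; have := ln2_ge_half.
have : ln (2 ^+ 2) <= ln x by rewrite ler_ln ?posrE ?exprn_gt0//; lra.
by rewrite lnXn// mulr2n; lra.
Qed.

Lemma dyadic_length x n : 16 <= x -> (0 < n)%N -> n%:R <= Num.sqrt x + 1 ->
  exists2 j, (n <= 2 ^ j)%N & (j%:R <= 2 * ln x :> R).
Proof.
move=> x16 n0 nx; exists (trunc_log 2 n).+1; first by rewrite ltnW// trunc_log_ltn.
have x0 : 0 < x by lra.
have s4 : 4 <= Num.sqrt x.
  have -> : 4 = Num.sqrt 16 :> R by rewrite (_ : 16 = 4 ^+ 2) ?sqrtr_sqr ?ger0_norm//; lra.
  by rewrite ler_wsqrtr.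
have Es : Num.sqrt x ^+ 2 = x by rewrite sqr_sqrtr// ltW.
have h : (2 ^ (trunc_log 2 n).+1)%:R <= x.
  have t1 : (2 ^ (trunc_log 2 n) <= n)%N by rewrite trunc_logP.
  rewrite expnS natrM; move: t1; rewrite -(ler_nat R) => t1.
  by rewrite -Es; nra.
have h2 : ln (2 ^ (trunc_log 2 n).+1)%:R <= ln x :> R.
  by rewrite ler_ln ?posrE ?ltr0n ?expn_gt0.
rewrite natrX lnXn// in h2.
rewrite -[_ *+ (trunc_log 2 n).+1]mulr_natl in h2.
have t0 : 0 <= (trunc_log 2 n).+1%:R :> R by [].
have := ler_wpM2l t0 ln2_ge_half; move: h2.
by move: (_.+1%:R : R) => t; lra.
Qed.

(** [count_decomp] at K = floor(sqrt(x/d)), where both ranges have length at most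
    sqrt(x/d). The main terms agree up to O(1), because L/d and x times the sum of
    the terms k > K of the series are both close to x/(d^2 K); the four sums of psi
    are bounded by [hyp_sum_dyadic]. *)
Lemma count_error : exists2 C : R, 0 < C & forall x d N, 16 <= x -> (0 < d)%N ->
  d%:R ^+ 2 <= x -> x < N%:R ->
  `|mult_count x d - x * mult_series R d N| <= C * ((x / d%:R) `^ (3^-1) * ln x).
Proof.
have [C0 C00 HC] : exists2 C : R, 0 < C & forall Y be ga j n, 1 <= Y -> 0 <= be <= 1 ->
   (n <= 2 ^ j)%N -> (n.-1)%:R ^+ 2 <= Y ^+ 3 ->
   `|\sum_(1 <= k < n) psi (hyp (Y ^+ 3) be k - ga)| <= j%:R * (C * Y).
  by exists 2000; [lra | exact: hyp_sum_dyadic].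
exists (8 * C0 + 3); first by lra.
move=> x d N x16 d0 dx xN.
have x0 : 0 < x by lra.
have dr0 : 0 < d%:R :> R by rewrite ltr0n.
have d1 : 1 <= d%:R :> R by rewrite ler1n.
pose y := x / d%:R.
have dlex : d%:R <= x by apply: le_trans dx; rewrite expr2 ler_peMr// ltW.
have y1 : 1 <= y by rewrite ler_pdivlMr// mul1r.
have y0 : 0 < y by lra.
pose Y := y `^ (3^-1).
have YE : Y ^+ 3 = y by rewrite -powR_mulrn ?powR_ge0// -powRrM mulVf// powRr1// ltW.
have Y1 : 1 <= Y by rewrite -(powRr0 y) ler_powR// invr_ge0.
pose K := Num.truncn (Num.sqrt y).
have Es : Num.sqrt y ^+ 2 = y by rewrite sqr_sqrtr// ltW.
have sy1 : 1 <= Num.sqrt y by rewrite -[leLHS]sqrtr1 ler_wsqrtr.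
have K0 : (0 < K)%N by rewrite truncn_gt0.
have Kr0 : 0 < K%:R :> R by rewrite ltr0n.
have K1 : 1 <= K%:R :> R by rewrite ler1n.
have /andP[Klo Khi] := truncn_itv (sqrtr_ge0 y); rewrite -/K in Klo Khi.
have KK : K%:R ^+ 2 <= y by rewrite -Es lerXn2r ?nnegrE ?sqrtr_ge0.
have yK : y < K.+1%:R ^+ 2 by rewrite -Es ltrXn2r ?nnegrE ?sqrtr_ge0.
pose L := Num.truncn (y / K.+1%:R).
have yKK0 : 0 <= y / K.+1%:R by rewrite divr_ge0// ltW.
have /andP[Llo Lhi] := truncn_itv yKK0; rewrite -/L in Llo Lhi.
have LK : (L <= K)%N.
  rewrite -ltnS -(ltr_nat R); apply: le_lt_trans Llo _.
  by rewrite ltr_pdivrMr ?ltr0n// -expr2.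
have syx : Num.sqrt y <= Num.sqrt x.
  by rewrite ler_wsqrtr// ler_pdivrMr// ler_peMr// ltW.
have [j Kj jx] : exists2 j, (K.+1 <= 2 ^ j)%N & (j%:R <= 2 * ln x :> R).
  by apply: dyadic_length => //; rewrite -natr1 lerD2r; lra.
have SB (be ga : R) n : 0 <= be <= 1 -> (n <= K)%N ->
    `|\sum_(1 <= k < n.+1) psi (hyp y be k - ga)| <= 2 * C0 * (Y * ln x).
  move=> be01 nK; rewrite -YE.
  apply: le_trans (HC Y be ga j n.+1 Y1 be01 _ _) _.
  - by apply: leq_trans Kj.
  - by rewrite YE; apply: le_trans KK; rewrite lerXn2r ?nnegrE// ler_nat.
  have -> : 2 * C0 * (Y * ln x) = (2 * ln x) * (C0 * Y) by ring.
  by apply: ler_wpM2r => //; rewrite mulr_ge0 ?ltW//; lra.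
have i01 : 0 <= (d%:R^-1 : R) <= 1 by rewrite invr_ge0 ler0n invf_le1.
have z01 : 0 <= (0 : R) <= 1 by rewrite lexx ler01.
pose M := (N.-1 %/ d)%N.
have NM : (N <= d * M.+1)%N.
  have := ltn_ceil N.-1 d0; rewrite -/M mulnC; case: (N) => //.
have Kdx : (K * d)%:R <= x.
  rewrite natrM; apply: (@le_trans _ _ (Num.sqrt y * d%:R)); first by rewrite ler_wpM2r.
  rewrite -(@ler_pXn2r _ 2) ?nnegrE ?mulr_ge0 ?sqrtr_ge0 ?(ltW x0)//.
  rewrite exprMn Es /y; have -> : x / d%:R * d%:R ^+ 2 = x * d%:R by field; rewrite gt_eqF.
  by rewrite expr2 ler_wpM2l// ltW.
have KM : (K <= M)%N.
  rewrite /M leq_divRL//; have : (K * d < N)%N by rewrite -(ltr_nat R); apply: le_lt_trans xN.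
  by case: (N).
(* Here the truncation at N is harmless: the terms beyond it add up to less
   than x / (d N) <= 1 after multiplication by x. *)
have Dtail : `|L%:R / d%:R - x * \sum_(K.+1 <= k < M.+1) mult_term d k| <= 3.
  have up := mult_tail_le d0 K0 KM; have lo := mult_tail_ge d0 K0 KM.
  have Ex : x = y * d%:R by rewrite /y divfK// gt_eqF.
  have up2 : x * \sum_(K.+1 <= k < M.+1) mult_term d k <= y / K%:R / d%:R.
    apply: le_trans (ler_wpM2l (ltW x0) up) _.
    have -> : x * ((K%:R^-1 - M%:R^-1) / d%:R ^+ 2) = y * (K%:R^-1 - M%:R^-1) / d%:R.
      by rewrite Ex; field; rewrite !gt_eqF// ltr0n (leq_trans K0).
    by rewrite ler_pM2r ?invr_gt0// ler_wpM2l ?(ltW y0)// gerBl.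
  have lo2 : (y / K.+1%:R - y / M.+1%:R) / d%:R <= x * \sum_(K.+1 <= k < M.+1) mult_term d k.
    apply: le_trans (ler_wpM2l (ltW x0) lo).
    rewrite le_eqVlt; apply/orP; left; apply/eqP.
    by rewrite Ex; field; rewrite !gt_eqF// ltr0n.
  have yM : y / M.+1%:R <= 1.
    rewrite ler_pdivrMr ?ltr0n// mul1r /y ler_pdivrMr// -natrM.
    by apply: le_trans (ltW xN) _; rewrite ler_nat mulnC.
  have yKb : y / K%:R - y / K.+1%:R <= 2.
    have -> : y / K%:R - y / K.+1%:R = y / (K%:R * K.+1%:R).
      by rewrite -natr1; field; rewrite !gt_eqF//; lra.
    rewrite ler_pdivrMr ?mulr_gt0 ?ltr0n//; apply: le_trans (ltW yK) _.
    by rewrite -natr1; nra.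
  have dle1 u : 0 <= u -> u / d%:R <= u by move=> u0; rewrite ler_piMr// invf_le1.
  have a1 : (y / K.+1%:R - L%:R) / d%:R <= 1.
    by apply: le_trans (dle1 _ _) _; [rewrite subr_ge0 | rewrite lerBlDr addrC natr1 ltW].
  have a2 : (y / K%:R - y / K.+1%:R) / d%:R <= 2.
    apply: le_trans (dle1 _ _) _ => //.
    by rewrite subr_ge0 ler_wpM2l ?(ltW y0)// lef_pV2 ?posrE ?ltr0n// ler_nat.
  have a3 : y / M.+1%:R / d%:R <= 1.
    by apply: le_trans (dle1 _ _) _ => //; rewrite divr_ge0// ltW.
  have a4 : L%:R / d%:R <= y / K.+1%:R / d%:R by rewrite ler_pM2r ?invr_gt0.
  rewrite !mulrBl in a1 a2 lo2; move: a1 a2 a3 a4 up2 lo2.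
  move: (y / K%:R / d%:R) (y / K.+1%:R / d%:R) (y / M.+1%:R / d%:R) (L%:R / d%:R).
  move=> b1 b2 b3 b4 a1 a2 a3 a4 up2 lo2.
  by rewrite ler_norml; apply/andP; split; lra.
rewrite (count_decomp (ltW x0) d0 K) mult_seriesE// -/M -/y -/L.
rewrite [X in _ - x * X](@big_cat_nat _ _ _ K.+1)//= mulrDr.
have lx := ln_ge1 x16.
have Yl : 1 <= Y * ln x by nra.
have := SB 0 0 K z01 (leqnn K); have := SB d%:R^-1 0 K i01 (leqnn K).
have := SB 0 0 L z01 LK; have := SB 0 d%:R^-1 L z01 LK.
move: Dtail; rewrite -/Y !ler_norml /mult_term.
set s1 := \sum_(_ <= _ < _) psi _; set s2 := \sum_(_ <= _ < _) psi _.
set s3 := \sum_(_ <= _ < _) psi _; set s4 := \sum_(_ <= _ < _) psi _.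
set m1 := x * _; set m2 := x * _.
move: (Y * ln x) Yl => z z1.
have -> : (8 * C0 + 3) * z = 4 * (2 * C0 * z) + 3 * z by ring.
move: (2 * C0 * z) => w.
move: m1 m2 s1 s2 s3 s4 (L%:R / d%:R : R) => m1 m2 s1 s2 s3 s4 l.
move=> /andP[? ?] /andP[? ?] /andP[? ?] /andP[? ?] /andP[? ?].
by apply/andP; split; lra.
Qed.

End CountError.

(** * Sums of powers *)

Section PowerSums.
Variable R : realType.
Implicit Types (a : nat -> R) (al be th s t x z B : R) (d n m j N X Y : nat).

Lemma powR_nexp t s n : 0 <= t -> (t ^+ n) `^ s = (t `^ s) ^+ n.
Proof. by move=> t0; rewrite -powR_mulrn// -powRrM mulrC powRrM powR_mulrn// powR_ge0. Qed.

(** Partial summation done on dyadic blocks: the block from 2^j Y to 2^(j+1) Y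
    contributes at most B 2^be (2^j Y)^(be - s), a geometric progression in j. *)
Lemma dyadic_tail a be s : 0 <= be -> be < s -> (forall d, 0 <= a d) ->
  forall B, (forall n, (0 < n)%N -> \sum_(1 <= d < n.+1) a d <= B * n%:R `^ be) ->
  forall Y X, (0 < Y)%N ->
  \sum_(Y <= d < X) a d * d%:R `^ (- s) <=
    2 `^ be / (1 - 2 `^ (be - s)) * (B * Y%:R `^ (be - s)).
Proof.
move=> be0 bes a0 B HB Y X Y0.
have Yr0 : 0 < Y%:R :> R by rewrite ltr0n.
have s0 : 0 < s by lra.
pose r : R := 2 `^ (be - s).
have r0 : 0 < r by rewrite powR_gt0.
have r1 : r < 1.
  have -> : r = (2 `^ (s - be))^-1 by rewrite /r -powRN opprB.
  rewrite invf_lt1 ?powR_gt0//.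
  have := @gt0_ltr_powR R (s - be) ltac:(lra) 1 2; rewrite powR1 !nnegrE; apply; lra.
have B0 : 0 <= B.
  have := HB 1%N isT; rewrite powR1 mulr1; apply: le_trans.
  by rewrite big_nat1.
pose c := B * 2 `^ be * Y%:R `^ (be - s).
have c0 : 0 <= c by rewrite !mulr_ge0 ?powR_ge0.
have claim j : \sum_(Y <= d < 2 ^ j * Y) a d * d%:R `^ (- s) <= c * ((1 - r ^+ j) / (1 - r)).
  elim: j => [|j IH]; first by rewrite mul1n big_geq// subrr mul0r mulr0.
  have h1 : (Y <= 2 ^ j * Y)%N by rewrite leq_pmull// expn_gt0.
  have h2 : (2 ^ j * Y <= 2 ^ j.+1 * Y)%N by rewrite leq_mul2r leq_exp2l// orbC leqnSn.
  rewrite (big_cat_nat h1 h2)/=; apply: le_trans (lerD IH (_ : _ <= c * r ^+ j)) _; last first.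
    rewrite -mulrDr ler_wpM2l// exprS le_eqVlt; apply/orP; left; apply/eqP.
    by field; rewrite gt_eqF// subr_gt0.
  have P0 : (0 < 2 ^ j * Y)%N by rewrite muln_gt0 expn_gt0.
  have Pr0 : 0 < (2 ^ j * Y)%:R :> R by rewrite ltr0n.
  apply: (@le_trans _ _ (\sum_(2 ^ j * Y <= d < 2 ^ j.+1 * Y) a d * (2 ^ j * Y)%:R `^ (- s))).
    apply: ler_sum_nat => d /andP[dl _]; apply: ler_wpM2l => //.
    rewrite !powRN lef_pV2 ?posrE ?powR_gt0 ?ltr0n ?(leq_trans P0)//.
    by apply: ge0_ler_powR; rewrite ?nnegrE ?(ltW s0)// ler_nat.
  rewrite -big_distrl /=.
  have G : \sum_(2 ^ j * Y <= d < 2 ^ j.+1 * Y) a d <= B * (2 ^ j.+1 * Y)%:R `^ be.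
    have P1 : (0 < 2 ^ j.+1 * Y)%N by rewrite muln_gt0 expn_gt0.
    apply: le_trans (HB _ P1).
    rewrite [leRHS](@big_cat_nat _ _ _ (2 ^ j * Y)%N)//=; last exact: leqW.
    rewrite [X in _ <= _ + X]big_nat_recr//=.
    have p1 : 0 <= \sum_(1 <= d < 2 ^ j * Y) a d by apply: sumr_ge0 => d _.
    by rewrite addrCA lerDl addr_ge0.
  apply: le_trans (ler_wpM2r (powR_ge0 _ _) G) _.
  have -> : (2 ^ j.+1 * Y)%:R = 2 * (2 ^ j * Y)%:R :> R by rewrite expnS -mulnA natrM.
  have -> : r ^+ j = ((2 ^ j)%:R : R) `^ (be - s) by rewrite natrX powR_nexp.
  rewrite powRM// /c -!mulrA -powRD; last by rewrite (gt_eqF Pr0) implybT.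
  by rewrite natrM powRM// (mulrC (Y%:R `^ _)).
have [XY|YX] := leqP X Y.
  by rewrite big_geq// !mulr_ge0 ?powR_ge0// invr_ge0 subr_ge0 ltW.
have XX : (X <= 2 ^ X * Y)%N.
  by apply: leq_trans (ltnW (ltn_expl X (ltnSn 1))) _; rewrite leq_pmulr.
apply: (@le_trans _ _ (\sum_(Y <= d < 2 ^ X * Y) a d * d%:R `^ (- s))).
  rewrite (big_cat_nat (ltnW YX) XX)/= lerDl sumr_ge0// => d _.
  by rewrite mulr_ge0 ?powR_ge0.
apply: le_trans (claim X) _.
have -> : 2 `^ be / (1 - r) * (B * Y%:R `^ (be - s)) = c * (1 / (1 - r)).
  by rewrite /c; ring.
have d0 : 0 < 1 - r by rewrite subr_gt0.
by rewrite ler_wpM2l// ler_pM2r ?invr_gt0// gerBl exprn_ge0// ltW.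
Qed.

(** By induction, from (1 - u)^r <= exp (- r u) <= 1 - r u / 2 with r = 1 - al and
    u = 1/(m+1): this bounds (m+1)^r - m^r from below by (r/2) (m+1)^(r-1). *)
Lemma sum_powRN al m : 0 <= al < 1 ->
  \sum_(1 <= n < m.+1) n%:R `^ (- al) <= 2 / (1 - al) * m%:R `^ (1 - al) :> R.
Proof.
move=> /andP[al0 al1]; have q0 : 0 < 1 - al by lra.
elim: m => [|m IH]; first by rewrite big_geq// powR0 ?mulr0// gt_eqF.
rewrite big_nat_recr//=; apply: le_trans (lerD IH (lexx _)) _.
set r := 1 - al in q0 *.
have n0 : 0 < m.+1%:R :> R by rewrite ltr0n.
pose u : R := m.+1%:R^-1.
have u0 : 0 < u by rewrite invr_gt0.
have u1 : u <= 1 by rewrite invf_le1// ler1n.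
have Em : m%:R = m.+1%:R * (1 - u) :> R.
  by rewrite mulrBr mulr1 /u divff ?gt_eqF// -natr1 addrK.
have B : (1 - u) `^ r <= 1 - r * u / 2.
  have e1 : 0 < 1 + r * u by rewrite addr_gt0// mulr_gt0.
  apply: (@le_trans _ _ (expR (- (r * u)))).
    apply: (@le_trans _ _ (expR (- u) `^ r)).
      apply: ge0_ler_powR; rewrite ?nnegrE ?expR_ge0 ?(ltW q0)//; first by lra.
      exact: expR_ge1Dx.
    by rewrite -expRM mulNr mulrC.
  rewrite expRN.
  apply: (@le_trans _ _ (1 + r * u)^-1).
    by rewrite lef_pV2 ?posrE ?expR_gt0// expR_ge1Dx.
  rewrite -[leLHS]mul1r ler_pdivrMr//.
  have : r * u <= 1 by rewrite /r; nra.
  have : 0 <= r * u by rewrite mulr_ge0// ltW.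
  move: (r * u) => v; nra.
rewrite {1}Em powRM//; last by lra.
have -> : m.+1%:R `^ (- al) = m.+1%:R `^ r * u.
  rewrite /u -powR_inv1 ?ler0n// -powRD; first by congr (_ `^ _); rewrite /r; ring.
  by rewrite (gt_eqF n0) implybT.
have := ler_wpM2l (powR_ge0 m.+1%:R r) B.
move: (m.+1%:R `^ r) (powR_ge0 m.+1%:R r) => p p0.
rewrite -subr_ge0 => h; rewrite -subr_ge0.
have -> : 2 / r * p - (2 / r * (p * (1 - u) `^ r) + p * u) =
  2 / r * (p * (1 - r * u / 2) - p * (1 - u) `^ r).
  by field; rewrite gt_eqF.
by rewrite mulr_ge0// divr_ge0// ltW.
Qed.

Lemma ln_le_powR t s : 0 < t -> 0 < s -> ln t <= t `^ s / s.
Proof.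
move=> t0 s0; rewrite ler_pdivlMr// mulrC -ln_powR.
by apply/ltW/ln_sublinear; rewrite powR_gt0.
Qed.

End PowerSums.

(** * Consequences of the summatory bound *)

Section Summatory.
Variable R : realType.
Implicit Types (a : nat -> R) (al be th s t x z A : R) (d n m j N X Y : nat).

Definition summatory_bound a A al th :=
  forall x, 2 <= x -> \sum_(1 <= d < (Num.truncn x).+1) a d <= A * (x `^ al * ln x `^ th).

(** A constant for which 2 (ln t)^th is at most [log_cst] times t^((1 - al)/6). It has
    the same value for all th in [[0, 1]], which matters when al = 0: the final
    constant is then [log_cst 0 1], whatever th <= 1 may be. *)
Definition log_cst al th : R :=
  2 * (Num.max 1 th / ((1 - al) / 6)) `^ Num.max 1 th.

Lemma ln_powR_le al th t : 0 <= al < 1 -> 0 <= th -> 2 <= t ->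
  2 * ln t `^ th <= log_cst al th * t `^ ((1 - al) / 6).
Proof.
move=> /andP[al0 al1] th0 t2; rewrite /log_cst; set m := Num.max 1 th.
have m1 : 1 <= m by rewrite le_max lexx.
have thm : th <= m by rewrite le_max lexx orbT.
have m0 : 0 < m by lra.
set e := (1 - al) / 6; have e0 : 0 < e by rewrite /e; lra.
have e1 : e <= 1 by rewrite /e; lra.
have t0 : 0 < t by lra.
pose w := t `^ (e / m) / (e / m).
have em0 : 0 < e / m by rewrite divr_gt0.
have w1 : 1 <= w.
  rewrite ler_pdivlMr// mul1r; apply: (@le_trans _ _ 1).
    by rewrite ler_pdivrMr// mul1r; lra.
  by rewrite -[leLHS](powRr0 t) ler_powR ?(ltW em0)//; lra.
have lw : ln t <= w by apply: ln_le_powR.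
have lt0 : 0 <= ln t by apply: ln_ge0; lra.
rewrite -mulrA ler_wpM2l//; apply: (@le_trans _ _ (w `^ th)).
  by apply: ge0_ler_powR; rewrite ?nnegrE//; lra.
apply: (@le_trans _ _ (w `^ m)); first by apply: ler_powR.
have -> : w = (m / e) * t `^ (e / m) by rewrite /w; field; rewrite !gt_eqF.
have me0 : 0 <= m / e by exact: divr_ge0 (ltW m0) (ltW e0).
by rewrite powRM ?powR_ge0// -powRrM divfK// gt_eqF.
Qed.

Lemma log_cst_ge2 al th : 0 <= al < 1 -> 2 <= log_cst al th.
Proof.
move=> /andP[al0 al1]; rewrite /log_cst; set m := Num.max 1 th.
have m1 : 1 <= m by rewrite le_max lexx.
have e0 : 0 < (1 - al) / 6 by lra.
have h : 1 <= m / ((1 - al) / 6) by rewrite ler_pdivlMr// mul1r; lra.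
have : 1 <= (m / ((1 - al) / 6)) `^ m.
  by rewrite -[leLHS](powRr0 (m / ((1 - al) / 6))) ler_powR//; lra.
by move: (_ `^ m) => u; lra.
Qed.

Section Bounds.
Variables (a : nat -> R) (A al th : R).
Hypotheses (al01 : 0 <= al < 1) (th0 : 0 <= th) (a0 : forall d, 0 <= a d)
  (HA : summatory_bound a A al th).

Lemma sum_mono n m : (n <= m)%N -> \sum_(1 <= d < n.+1) a d <= \sum_(1 <= d < m.+1) a d.
Proof.
move=> nm; rewrite [leRHS](@big_cat_nat _ _ _ n.+1)//= lerDl.
by apply: sumr_ge0 => d _.
Qed.

Lemma summatory_cst_ge0 : 0 <= A.
Proof.
have := HA (lexx 2); have p : 0 < (2 : R) `^ al * ln 2 `^ th.
  by rewrite mulr_gt0 ?powR_gt0// ln_gt0//; lra.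
move=> h; rewrite -(pmulr_lge0 _ p); apply: le_trans h.
by apply: sumr_ge0 => d _.
Qed.

Lemma summatory_one : \sum_(1 <= d < 2) a d <= 2 * A.
Proof.
have /andP[al0 al1] := al01; have A0 := summatory_cst_ge0.
apply: (@le_trans _ _ (\sum_(1 <= d < 3) a d)); first exact: (@sum_mono 1 2).
have := HA (lexx 2); rewrite natrK; move/le_trans; apply.
rewrite mulrC ler_wpM2r// -[leRHS]mulr1; apply: ler_pM; rewrite ?powR_ge0//.
  by rewrite ler1_powR//; lra.
have e1 : 1 `^ th = 1 :> R by rewrite powR1.
rewrite -[leRHS]e1; apply: ge0_ler_powR; rewrite ?nnegrE//.
  by rewrite ln_ge0//; lra.
have h : -1 < 1 :> R by lra.
by have := le_ln1Dx h; rewrite -[1 + 1]/(2%:R).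
Qed.

Lemma summatory_below x n : 16 <= x -> (0 < n)%N -> n%:R <= x ->
  \sum_(1 <= d < n.+1) a d <= (2 * A * ln x `^ th) * n%:R `^ al.
Proof.
move=> x16 n0 nx; have A0 := summatory_cst_ge0; have /andP[al0 al1] := al01.
have [n2|n1] := leqP 2 n.
  have h2 : 2 <= n%:R :> R by rewrite ler_nat.
  have := HA h2; rewrite natrK; move/le_trans; apply.
  have -> : 2 * A * ln x `^ th * n%:R `^ al = A * (n%:R `^ al * (2 * ln x `^ th)) by ring.
  rewrite ler_wpM2l// ler_wpM2l ?powR_ge0//.
  apply: (@le_trans _ _ (ln x `^ th)).
    by apply: ge0_ler_powR; rewrite ?nnegrE ?ln_ge0 ?ler_ln ?posrE//; lra.
  by rewrite ler_peMl ?powR_ge0//; lra.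
have -> : n = 1%N by apply/eqP; rewrite eqn_leq n0 andbT -ltnS.
apply: le_trans summatory_one _; rewrite powR1 mulr1 ler_peMr ?mulr_ge0//.
have lx := ln_ge1 x16.
by rewrite -[leLHS](powRr0 (ln x)) ler_powR.
Qed.

(** The exponent al + (1 - al)/6 is less than 1 and less than al + 1/3, so that the
    sums of [a d / d] and of [a d / d^(al + 1/3)] converge. *)
Lemma summatory_pow n : (0 < n)%N ->
  \sum_(1 <= d < n.+1) a d <= (A * log_cst al th) * n%:R `^ (al + (1 - al) / 6).
Proof.
move=> n0; have A0 := summatory_cst_ge0; have /andP[al0 al1] := al01.
have [n2|n1] := leqP 2 n.
  have h2 : 2 <= n%:R :> R by rewrite ler_nat.
  have := HA h2; rewrite natrK; move/le_trans; apply.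
  rewrite powRD; last by rewrite (gt_eqF (_ : 0 < n%:R)) ?implybT// ltr0n.
  have -> : forall u v w : R, A * u * (v * w) = A * (v * (u * w)) by move=> *; ring.
  rewrite ler_wpM2l// ler_wpM2l ?powR_ge0//.
  apply: le_trans (ln_powR_le al01 th0 h2).
  by rewrite ler_peMl ?powR_ge0//; lra.
have -> : n = 1%N by apply/eqP; rewrite eqn_leq n0 andbT -ltnS.
apply: le_trans summatory_one _; rewrite powR1 mulr1 mulrC ler_wpM2l//.
exact: log_cst_ge2.
Qed.

End Bounds.

(** No cancellation is used here: for n > n0 the multiples k d of d that occur are at
    most W, and each is reached for at most x/(kd) - x/(kd+1) + 1 values of n. *)
Lemma mult_count_le x (W : R) d n0 : 0 <= x -> 0 <= W -> (0 < d)%N ->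
  (n0 <= Num.truncn x)%N ->
  (forall n, (n0 < n)%N -> x / n%:R <= W) ->
  mult_count x d <= \sum_(1 <= n < n0.+1) (d %| Num.truncn (x / n%:R))%:R
     + 2 * x / d%:R ^+ 2 + W / d%:R.
Proof.
move=> x0 W0 d0 nX HW; have dr0 : 0 < d%:R :> R by rewrite ltr0n.
pose K := Num.truncn (W / d%:R).
have Wd0 : 0 <= W / d%:R by rewrite divr_ge0.
have /andP[K1 K2] := truncn_itv Wd0; rewrite -/K in K1 K2.
have P1 : mult_count x d <= \sum_(1 <= n < n0.+1) (d %| Num.truncn (x / n%:R))%:R
   + \sum_(1 <= n < (Num.truncn x).+1) \sum_(1 <= k < K.+1) (Num.truncn (x / n%:R) == k * d)%N%:R.
  have <- : \sum_(1 <= n < (Num.truncn x).+1) (d %| Num.truncn (x / n%:R))%:R * (n <= n0)%:R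
     = \sum_(1 <= n < n0.+1) (d %| Num.truncn (x / n%:R))%:R :> R.
    rewrite (@big_cat_nat _ _ _ n0.+1)//=.
    rewrite [X in _ + X]big1_seq ?addr0; last first.
      move=> n; rewrite mem_index_iota => /andP[_ /andP[Ln _]].
      by rewrite leqNgt Ln mulr0.
    by apply: eq_big_nat => n /andP[_]; rewrite ltnS => ->; rewrite mulr1.
  rewrite -big_split /=; apply: ler_sum_nat => n /andP[n1 nx].
  have q0 : (0 < Num.truncn (x / n%:R))%N by rewrite -truncn_div_swap// divr1 -ltnS.
  rewrite [leLHS](dvdn_split _ K d0 q0) [leLHS]addrC; apply: lerD => //.
  apply: ler_wpM2l => //; rewrite ler_nat.
  have [_|n0n] := leqP n n0; first exact: leq_b1.
  suff -> : (K.+1 * d <= Num.truncn (x / n%:R))%N = false by [].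
  apply: negbTE; rewrite -ltnNge truncn_lt_nat ?divr_ge0//.
  apply: le_lt_trans (HW _ n0n) _.
  by rewrite natrM -ltr_pdivrMr.
apply: le_trans P1 _; rewrite -addrA lerD2l exchange_big /=.
apply: (@le_trans _ _ (\sum_(1 <= k < K.+1) (x * mult_term R d k + 1))).
  apply: ler_sum_nat => k /andP[k0 _].
  rewrite count_eq ?muln_gt0 ?k0//.
  have kd0 : 0 < (k * d)%:R :> R by rewrite ltr0n muln_gt0 k0.
  have /andP[h1 _] := truncn_itv (divr_ge0 x0 (ltW kd0)).
  have := truncnS_gt (x / (k * d).+1%:R); rewrite -[X in _ < X]natr1 => h2.
  have -> : x * mult_term R d k = x / (k * d)%:R - x / (k * d).+1%:R.
    rewrite /mult_term; move: (k * d)%N kd0 => M M0.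
    by rewrite natrM -natr1; field; rewrite !gt_eqF//; lra.
  move: h1 h2; move: (x / (k * d)%:R) (x / (k * d).+1%:R) => u v h1 h2; lra.
rewrite big_split /= -big_distrr /= sumr_const_nat subn1 /=.
apply: lerD => //.
rewrite mulrAC [leRHS]mulrC ler_wpM2l//.
have := mult_series_le R (K * d).+1 d0; rewrite mult_seriesE//= mulnK//.
Qed.

End Summatory.

(** * The three ranges of divisors *)

Section Parts.
Variable R : realType.
Implicit Types (a : nat -> R) (al be th s t x z A : R) (d n m j N X Y : nat).

Lemma powRDp t s r : 0 < t -> t `^ s * t `^ r = t `^ (s + r).
Proof. by move=> t0; rewrite powRD// (gt_eqF t0) implybT. Qed.

Lemma powRV t s : 0 <= t -> t^-1 `^ s = t `^ (- s).
Proof. by move=> t0; rewrite -[t^-1]powR_inv1// -powRrM mulN1r. Qed.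

(** The divisors are cut at z = x^(1/(3 - al)). In terms of z the target
    x^((1 + al)/(3 - al)) is z^(1 + al), which is z^2 times z^(al - 1). *)
Definition cutoff al x : R := x `^ (3 - al)^-1.

Lemma cutoffP al x : 0 <= al < 1 -> 16 <= x ->
  [/\ 1 <= cutoff al x, cutoff al x `^ (3 - al) = x, cutoff al x ^+ 2 <= x & cutoff al x <= x].
Proof.
move=> /andP[al0 al1] x16; have x0 : 0 < x by lra.
have q0 : 0 < 3 - al by lra.
have z1 : 1 <= cutoff al x.
  by rewrite -[leLHS](powRr0 x) ler_powR ?invr_ge0 ?(ltW q0)//; lra.
have E : cutoff al x `^ (3 - al) = x by rewrite -powRrM mulVf ?gt_eqF// powRr1// ltW.
have z2 : cutoff al x ^+ 2 <= x.
  by rewrite -[leRHS]E -powR_mulrn ?powR_ge0// ler_powR//; lra.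
split=> //; apply: le_trans z2; rewrite expr2 ler_peMr//; lra.
Qed.

Lemma mult_count_eq0 x d : 0 <= x -> (Num.truncn x < d)%N -> mult_count x d = 0.
Proof.
move=> x0 xd; rewrite /mult_count big1_seq// => n.
rewrite mem_index_iota => /andP[_ /andP[n1 nX]].
have q0 : (0 < Num.truncn (x / n%:R))%N by rewrite -truncn_div_swap// divr1 -ltnS.
have qX : (Num.truncn (x / n%:R) <= Num.truncn x)%N.
  by apply: le_truncn; rewrite ler_pdivrMr ?ltr0n// ler_peMr// ler1n.
by rewrite gtnNdvd// (leq_ltn_trans qX).
Qed.

Lemma mult_count_ge0 x d : 0 <= mult_count x d.
Proof. by apply: sumr_ge0 => n _. Qed.

(** [count_error] gives O((x/d)^(1/3) ln x), and d^(-1/3) <= z^al d^(-al - 1/3) makes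
    the sum over d converge. The exponent 1 + 2 al/3 of z is less than 1 + al, except
    for al = 0; this is where the factor ln x is lost when al = 0. *)
Lemma small_divisors al : 0 <= al < 1 -> exists2 C : R, 0 <= C &
  forall a A th, 0 <= th -> (forall d, 0 <= a d) -> summatory_bound a A al th ->
  forall x N, 16 <= x -> x < N%:R ->
  \sum_(1 <= d < Num.truncn (cutoff al x)) a d * `|mult_count x d - x * mult_series R d N|
   <= C * (A * log_cst al th) * (ln x * cutoff al x `^ (1 + 2 * al / 3)).
Proof.
move=> al01; have /andP[al0 al1] := al01.
have [C1 C10 HC] := count_error R.
pose be := al + (1 - al) / 6; pose s := al + 3^-1.
have be0 : 0 <= be by rewrite /be; lra.
have bes : be < s by rewrite /be /s; lra.
pose C2 : R := 2 `^ be / (1 - 2 `^ (be - s)).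
exists `|C1 * C2| => // a A th th0 a0 HA x N x16 xN.
have [z1 zx z2 zlex] := cutoffP al01 x16.
set z := cutoff al x in z1 zx z2 zlex *.
have x0 : 0 < x by lra.
have z0 : 0 < z by lra.
have lx : 0 <= ln x by apply: ln_ge0; lra.
have B := dyadic_tail be0 bes a0 (summatory_pow al01 th0 a0 HA) (Num.truncn z) (ltn0Sn 0).
rewrite powR1 mulr1 -/C2 in B.
apply: (@le_trans _ _ (\sum_(1 <= d < Num.truncn z)
    C1 * (ln x * z `^ (1 + 2 * al / 3)) * (a d * d%:R `^ (- s)))); last first.
  rewrite -big_distrr /=.
  have c0 : 0 <= C1 * (ln x * z `^ (1 + 2 * al / 3)).
    by rewrite !mulr_ge0 ?powR_ge0// ltW.
  apply: le_trans (ler_wpM2l c0 B) _.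
  have A0 : 0 <= A * log_cst al th.
    rewrite mulr_ge0 ?(summatory_cst_ge0 a0 HA)//.
    by apply: le_trans (log_cst_ge2 th al01).
  have L0 : 0 <= ln x * z `^ (1 + 2 * al / 3) by rewrite mulr_ge0 ?powR_ge0.
  have -> : C1 * (ln x * z `^ (1 + 2 * al / 3)) * (C2 * (A * log_cst al th))
     = (C1 * C2) * (A * log_cst al th) * (ln x * z `^ (1 + 2 * al / 3)) by ring.
  by apply: ler_wpM2r => //; apply: ler_wpM2r => //; apply: ler_norm.
apply: ler_sum_nat => d /andP[d0 dz].
have dr0 : 0 < d%:R :> R by rewrite ltr0n.
have dz' : d%:R <= z.
  by apply: le_trans (_ : (Num.truncn z)%:R <= z); [rewrite ler_nat ltnW | rewrite truncn_le; lra].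
have d2x : d%:R ^+ 2 <= x.
  by apply: le_trans z2; rewrite lerXn2r ?nnegrE// ltW.
have := HC x d N x16 d0 d2x xN.
have E3 : (x / d%:R) `^ 3^-1 <= z `^ (1 + 2 * al / 3) * d%:R `^ (- s).
  rewrite powRM ?invr_ge0 ?(ltW x0)// -[in X in X `^ _ * _]zx -powRrM.
  have -> : (d%:R^-1 : R) `^ 3^-1 = d%:R `^ al * d%:R `^ (- s).
    rewrite powRDp// powRV//; congr (_ `^ _); rewrite /s; ring.
  rewrite mulrA; apply: ler_wpM2r; first exact: powR_ge0.
  have -> : z `^ (1 + 2 * al / 3) = z `^ ((3 - al) / 3) * z `^ al.
    by rewrite powRDp//; congr (_ `^ _); field.
  apply: ler_wpM2l; first exact: powR_ge0.
  by apply: ge0_ler_powR; rewrite ?nnegrE// ltW.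
move=> h; have -> : C1 * (ln x * z `^ (1 + 2 * al / 3)) * (a d * d%:R `^ (- s))
    = a d * (C1 * ((z `^ (1 + 2 * al / 3) * d%:R `^ (- s)) * ln x)) by ring.
apply: ler_wpM2l => //; apply: le_trans h _.
by apply: ler_wpM2l; [exact: ltW | apply: ler_wpM2r].
Qed.

(** For d > x the counts vanish and x times the series is at most 2 x / d^2 <= 2 / d. *)
Lemma large_divisors al : 0 <= al < 1 -> exists2 C : R, 0 <= C &
  forall a A th, 0 <= th -> (forall d, 0 <= a d) -> summatory_bound a A al th ->
  forall x N, 16 <= x ->
  \sum_((Num.truncn x).+1 <= d < N) a d * `|mult_count x d - x * mult_series R d N|
   <= C * (A * log_cst al th).
Proof.
move=> al01; have /andP[al0 al1] := al01.
pose be := al + (1 - al) / 6.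
have be0 : 0 <= be by rewrite /be; lra.
have be1 : be < 1 by rewrite /be; lra.
pose C2 : R := 2 `^ be / (1 - 2 `^ (be - 1)).
exists `|2 * C2| => // a A th th0 a0 HA x N x16.
have x0 : 0 < x by lra.
have B := dyadic_tail be0 be1 a0 (summatory_pow al01 th0 a0 HA) N (ltn0Sn 0).
rewrite powR1 mulr1 -/C2 in B.
have A0 : 0 <= A * log_cst al th.
  rewrite mulr_ge0 ?(summatory_cst_ge0 a0 HA)//.
  by apply: le_trans (log_cst_ge2 th al01).
apply: (@le_trans _ _ (2 * (C2 * (A * log_cst al th)))); last first.
  by rewrite mulrA ler_wpM2r// ler_norm.
apply: le_trans (ler_wpM2l (ler0n R 2) B).
have [XN|NX] := leqP (Num.truncn x).+1 N; last first.
  rewrite big_geq; last exact: ltnW.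
  by rewrite mulr_ge0// sumr_ge0// => d _; rewrite mulr_ge0 ?powR_ge0.
rewrite [X in _ <= _ * X](@big_cat_nat _ _ _ (Num.truncn x).+1)//= mulrDr.
apply: (@le_trans _ _ (2 * \sum_((Num.truncn x).+1 <= d < N) a d * d%:R `^ (- 1))); last first.
  by rewrite lerDr mulr_ge0// sumr_ge0// => d _; rewrite mulr_ge0 ?powR_ge0.
rewrite big_distrr /=; apply: ler_sum_nat => d /andP[dX _].
have d0 : (0 < d)%N by apply: leq_ltn_trans dX.
have dr0 : 0 < d%:R :> R by rewrite ltr0n.
rewrite mult_count_eq0 ?(ltW x0)// sub0r normrN.
rewrite ger0_norm; last by rewrite mulr_ge0 ?mult_series_ge0 ?ltW.
rewrite [leRHS]mulrCA ler_wpM2l// powR_inv1 ?ler0n//.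
apply: le_trans (ler_wpM2l (ltW x0) (mult_series_le R N d0)) _.
have xd : x <= d%:R.
  by apply: ltW; apply: lt_le_trans (truncnS_gt x) _; rewrite ler_nat.
have -> : x * (2 / d%:R ^+ 2) = (2 / d%:R) * (x / d%:R) by field; rewrite gt_eqF.
by rewrite ler_piMr ?divr_ge0// ler_pdivrMr// mul1r.
Qed.

(** This range determines the exponent. The n <= z^(1 - al) contribute at most the
    sum of (x/n)^al, by the bound on partial sums of [a]; the other n have
    x/n <= z^2, and contribute O(z^2/d) for each d >= z. Both amount to z^(1 + al),
    up to the power of the logarithm. *)
Lemma middle_divisors al : 0 <= al < 1 -> exists2 C : R, 0 <= C &
  forall a A th, 0 <= th -> (forall d, 0 <= a d) -> summatory_bound a A al th ->
  forall x N, 16 <= x ->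
  \sum_(Num.truncn (cutoff al x) <= d < (Num.truncn x).+1)
      a d * `|mult_count x d - x * mult_series R d N|
   <= C * (A * (ln x `^ th * cutoff al x `^ (1 + al))).
Proof.
move=> al01; have /andP[al0 al1] := al01.
pose C2 : R := 2 `^ al / (1 - 2 `^ (al - 1)).
have r1 : 2 `^ (al - 1) <= 1 :> R.
  by rewrite -[leRHS](powRr0 2) ler_powR//; lra.
have C20 : 0 <= C2 by rewrite divr_ge0 ?powR_ge0 ?subr_ge0.
exists (2 * (2 / (1 - al)) + 9 * (C2 * 4)).
  apply: addr_ge0; first by rewrite mulr_ge0// divr_ge0//; lra.
  by apply: mulr_ge0 => //; apply: mulr_ge0.
move=> a A th th0 a0 HA x N x16.
have [z1 zx z2 zlex] := cutoffP al01 x16.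
set z := cutoff al x in z1 zx z2 zlex *.
have x0 : 0 < x by lra.
have z0 : 0 < z by lra.
have A0 := summatory_cst_ge0 a0 HA.
have lt0 : 0 <= ln x `^ th by apply: powR_ge0.
pose X := Num.truncn x; pose D := Num.truncn z.
have D0 : (0 < D)%N by rewrite truncn_gt0.
have Dz2 : z / 2 <= D%:R.
  have := truncnS_gt z; rewrite -natr1 -/D.
  have : 1 <= D%:R :> R by rewrite ler1n.
  by lra.
pose w := z `^ (1 - al).
have w1 : 1 <= w by rewrite -[leLHS](powRr0 z) ler_powR//; lra.
have wz : w <= z by apply: ler1_powR => //; lra.
pose n0 := Num.truncn w.
have n0X : (n0 <= X)%N by apply: le_truncn; lra.
have n0w : n0%:R <= w by rewrite truncn_le; lra.
have xw : x = z ^+ 2 * w.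
  by rewrite -[LHS]zx -powR_mulrn ?(ltW z0)// powRDp//; congr (_ `^ _); ring.
have cnt d : (D <= d)%N -> `|mult_count x d - x * mult_series R d N| <=
    \sum_(1 <= n < n0.+1) (d %| Num.truncn (x / n%:R))%:R + 9 * z ^+ 2 / d%:R.
  move=> Dd; have d0 : (0 < d)%N by apply: leq_trans Dd.
  have dr0 : 0 < d%:R :> R by rewrite ltr0n.
  have zd : z / 2 <= d%:R by apply: le_trans Dz2 _; rewrite ler_nat.
  have h0 := mult_count_le (ltW x0) (sqr_ge0 z) d0 n0X.
  have h1 : mult_count x d <= \sum_(1 <= n < n0.+1) (d %| Num.truncn (x / n%:R))%:R
      + 2 * x / d%:R ^+ 2 + z ^+ 2 / d%:R.
    apply: h0 => n hn; have nr0 : 0 < n%:R :> R by rewrite ltr0n; apply: leq_ltn_trans hn.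
    rewrite ler_pdivrMr// xw ler_wpM2l ?sqr_ge0//.
    by apply: ltW; apply: lt_le_trans (truncnS_gt w) _; rewrite ler_nat.
  have h2 : x * mult_series R d N <= 2 * x / d%:R ^+ 2.
    apply: le_trans (ler_wpM2l (ltW x0) (mult_series_le R N d0)) _.
    by rewrite mulrA (mulrC x).
  have h3 : 2 * x / d%:R ^+ 2 <= 4 * (z ^+ 2 / d%:R).
    have -> : 2 * x / d%:R ^+ 2 = 2 * (z ^+ 2 / d%:R) * (w / d%:R).
      by rewrite xw; field; rewrite gt_eqF.
    have : w / d%:R <= 2 by rewrite ler_pdivrMr//; lra.
    have : 0 <= z ^+ 2 / d%:R by rewrite divr_ge0 ?sqr_ge0 ?ltW.
    by move: (z ^+ 2 / d%:R) (w / d%:R) => u v; nra.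
  have h4 : 0 <= x * mult_series R d N by rewrite mulr_ge0 ?mult_series_ge0 ?ltW.
  have h5 := mult_count_ge0 x d.
  have h6 : 0 <= \sum_(1 <= n < n0.+1) (d %| Num.truncn (x / n%:R))%:R :> R by apply: sumr_ge0.
  have h7 : 0 <= z ^+ 2 / d%:R by rewrite divr_ge0 ?sqr_ge0 ?ltW.
  rewrite -(mulrA 9).
  move: h1 h2 h3 h4 h5 h6 h7; move: (z ^+ 2 / d%:R) (2 * x / d%:R ^+ 2) => u v.
  move: (\sum_(_ <= _ < _) _) (mult_count x d) (x * mult_series R d N) => p q r.
  by move=> *; rewrite ler_norml; apply/andP; split; lra.
apply: (@le_trans _ _ (\sum_(D <= d < X.+1)
   (\sum_(1 <= n < n0.+1) a d * (d %| Num.truncn (x / n%:R))%:R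
     + 9 * z ^+ 2 * (a d * d%:R `^ (- 1))))).
  apply: ler_sum_nat => d /andP[Dd _].
  rewrite -big_distrr /= powR_inv1 ?ler0n//.
  have -> : 9 * z ^+ 2 * (a d / d%:R) = a d * (9 * z ^+ 2 / d%:R) by ring.
  by rewrite -mulrDr ler_wpM2l// cnt.
rewrite big_split [leRHS]mulrDl; apply: lerD.
  rewrite exchange_big /=.
  apply: (@le_trans _ _ (\sum_(1 <= n < n0.+1)
     (2 * A * ln x `^ th * x `^ al) * n%:R `^ (- al))).
    apply: ler_sum_nat => n /andP[n1 nn0].
    have nr0 : 0 < n%:R :> R by rewrite ltr0n.
    have nX : (n <= X)%N by apply: leq_trans n0X.
    set q := Num.truncn (x / n%:R).
    have q0 : (0 < q)%N by rewrite /q -truncn_div_swap ?(ltW x0)// divr1.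
    have xn0 : 0 <= x / n%:R by rewrite divr_ge0 ?ltW.
    have qx : q%:R <= x / n%:R by rewrite truncn_le.
    have qlex : q%:R <= x.
      by apply: le_trans qx _; rewrite ler_pdivrMr// ler_peMr ?(ltW x0)// ler1n.
    apply: (@le_trans _ _ (\sum_(1 <= d < q.+1) a d)).
      apply: (@le_trans _ _ (\sum_(1 <= d < X.+1) a d * (d <= q)%N%:R)).
        rewrite [leRHS](@big_cat_nat _ _ _ D)//=; last first.
          by rewrite ltnW// ltnS; apply: le_truncn.
        rewrite -[leLHS]add0r; apply: lerD; first by apply: sumr_ge0 => d _; rewrite mulr_ge0.
        apply: ler_sum => d _; apply: ler_wpM2l => //; rewrite ler_nat.
        case: (boolP (d %| q)%N) => // dq.
        by rewrite (dvdn_leq q0 dq).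
      have qX : (q <= X)%N by rewrite /X truncn_ge_nat ?(ltW x0).
      rewrite (@big_cat_nat _ _ _ q.+1)//= [X in _ + X]big1_seq ?addr0; last first.
        by move=> d; rewrite mem_index_iota => /andP[_ /andP[qd _]]; rewrite leqNgt qd mulr0.
      by apply: ler_sum_nat => d /andP[_]; rewrite ltnS => ->; rewrite mulr1.
    apply: le_trans (summatory_below al01 th0 a0 HA x16 q0 qlex) _.
    rewrite -[leRHS]mulrA ler_wpM2l ?mulr_ge0//.
    have -> : x `^ al * n%:R `^ (- al) = (x / n%:R) `^ al.
      by rewrite (powRM _ (ltW x0)) ?invr_ge0// powRV.
    by apply: ge0_ler_powR; rewrite ?nnegrE.
  rewrite -big_distrr /=.
  have c0 : 0 <= 2 * A * ln x `^ th * x `^ al by rewrite !mulr_ge0// powR_ge0.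
  apply: le_trans (ler_wpM2l c0 (sum_powRN n0 al01)) _.
  have e1 : n0%:R `^ (1 - al) <= w `^ (1 - al).
    by apply: ge0_ler_powR; rewrite ?nnegrE//; lra.
  have e2 : x `^ al * w `^ (1 - al) = z `^ (1 + al).
    rewrite -[in LHS]zx /w -!powRrM powRDp//; congr (_ `^ _); ring.
  have -> : 2 * (2 / (1 - al)) * (A * (ln x `^ th * z `^ (1 + al)))
     = 2 * A * ln x `^ th * x `^ al * (2 / (1 - al) * w `^ (1 - al)).
    by rewrite -e2; ring.
  apply: ler_wpM2l => //; apply: ler_wpM2l => //.
  by apply: divr_ge0 => //; rewrite subr_ge0 ltW.
rewrite -big_distrr /=.
(* The logarithm is bounded by ln x only up to x: cutting off [a] there gives
   a summatory bound without logarithm, as dyadic_tail requires. *)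
pose a' d := if (d <= X)%N then a d else 0.
have a'0 d : 0 <= a' d by rewrite /a'; case: ifP.
have a'B n : (0 < n)%N -> \sum_(1 <= d < n.+1) a' d <= 2 * A * ln x `^ th * n%:R `^ al.
  move=> n1; have [nX|Xn] := leqP n X.
    apply: le_trans (summatory_below al01 th0 a0 HA x16 n1 _); last first.
      by apply: le_trans (_ : X%:R <= x); [rewrite ler_nat | rewrite truncn_le ltW].
    by apply: ler_sum => d _; rewrite /a'; case: ifP.
  have X0 : (0 < X)%N by rewrite truncn_gt0; lra.
  have Xx : X%:R <= x by rewrite truncn_le ltW.
  apply: le_trans (le_trans (summatory_below al01 th0 a0 HA x16 X0 Xx) _); last first.
    rewrite ler_wpM2l ?mulr_ge0//; apply: ge0_ler_powR; rewrite ?nnegrE//.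
    by rewrite ler_nat ltnW.
  rewrite (@big_cat_nat _ _ _ X.+1)//=; last exact: leqW.
  rewrite [X in _ + X]big1_seq ?addr0; last first.
    by move=> d; rewrite mem_index_iota /a' => /andP[_ /andP[Xd _]]; rewrite leqNgt Xd.
  by apply: ler_sum => d _; rewrite /a'; case: ifP.
have B := dyadic_tail al0 al1 a'0 a'B X.+1 D0; rewrite -/C2 in B.
have Ea : \sum_(D <= d < X.+1) a d * d%:R `^ (- 1) = \sum_(D <= d < X.+1) a' d * d%:R `^ (- 1).
  by apply: eq_big_nat => d /andP[_]; rewrite ltnS /a' => ->.
rewrite Ea; apply: le_trans (ler_wpM2l _ B) _; first by rewrite mulr_ge0 ?sqr_ge0.
have Dp : D%:R `^ (al - 1) <= 2 * z `^ (al - 1).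
  have -> : al - 1 = - (1 - al) by ring.
  rewrite !powRN.
  have h : (z / 2) `^ (1 - al) <= D%:R `^ (1 - al).
    by apply: ge0_ler_powR; rewrite ?nnegrE ?divr_ge0//; lra.
  have h2 : z `^ (1 - al) / 2 <= (z / 2) `^ (1 - al).
    rewrite powRM ?invr_ge0 ?(ltW z0)// ler_wpM2l ?powR_ge0//.
    rewrite -{1}(@powRr1 _ (2^-1)) ?invr_ge0//.
    by apply: ger_powR; lra.
  have p0 : 0 < z `^ (1 - al) by rewrite powR_gt0.
  have -> : 2 * (z `^ (1 - al))^-1 = (z `^ (1 - al) / 2)^-1 by field; rewrite gt_eqF.
  rewrite lef_pV2 ?posrE ?divr_gt0// ?powR_gt0 ?ltr0n//.
  exact: le_trans h2 h.
have Ez : z ^+ 2 * z `^ (al - 1) = z `^ (1 + al).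
  by rewrite -powR_mulrn ?(ltW z0)// powRDp//; congr (_ `^ _); ring.
have -> : 9 * (C2 * 4) * (A * (ln x `^ th * z `^ (1 + al)))
   = 9 * z ^+ 2 * (C2 * (2 * A * ln x `^ th * (2 * z `^ (al - 1)))).
  by rewrite -Ez; ring.
apply: ler_wpM2l; first by rewrite mulr_ge0 ?sqr_ge0.
apply: ler_wpM2l => //; apply: ler_wpM2l => //.
by rewrite !mulr_ge0.
Qed.

End Parts.

(** * The bound for nonnegative weights *)

Section MainBound.
Variable R : realType.
Implicit Types (a : nat -> R) (al be th s t x z A : R) (d n m j N X Y : nat).

Definition log_exp al th : R := if al == 0 then Num.max 1 th else th.

Lemma log_exp_ge al th : th <= log_exp al th.
Proof. by rewrite /log_exp; case: ifP => // _; rewrite le_max lexx orbT. Qed.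

Lemma cutoff_powR al x s : cutoff al x `^ s = x `^ (s / (3 - al)).
Proof. by rewrite /cutoff -powRrM mulrC. Qed.

(** For al > 0 a power of x is to spare, which for large x exceeds ln x and the
    constant depending on th. For al = 0 and th > 1 the spare factor is
    (ln x)^(th - 1); for al = 0 and th <= 1 there is nothing to spare, but
    [log_cst] does not depend on th. *)
Lemma log_cst_absorb al th : 0 <= al < 1 -> 0 <= th -> exists2 x0 : R, 16 <= x0 &
  forall x, x0 <= x -> log_cst al th * (ln x * cutoff al x `^ (1 + 2 * al / 3)) <=
     log_cst al 1 * (x `^ ((1 + al) / (3 - al)) * ln x `^ log_exp al th).
Proof.
move=> al01 th0; have /andP[al0 al1] := al01; rewrite /log_exp.
have L2 := log_cst_ge2 th al01; have L1 := log_cst_ge2 1 al01.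
case: eqP => [al00|/eqP aln0].
  have Ez x : cutoff al x `^ (1 + 2 * al / 3) = x `^ ((1 + al) / (3 - al)).
    by rewrite cutoff_powR al00 mulr0 mul0r.
  have [th1|th1] := leP th 1.
    exists 16 => // x x16; rewrite Ez.
    have -> : log_cst al th = log_cst al 1.
      by rewrite /log_cst (max_idPl th1) (max_idPl (lexx 1)).
    rewrite powRr1; last by have := ln_ge1 x16; lra.
    by rewrite (mulrC (ln x)).
  have t0 : 0 < th - 1 by lra.
  pose u := log_cst al th `^ (th - 1)^-1.
  exists (Num.max 16 (expR u)); first by rewrite le_max lexx.
  move=> x; rewrite ge_max => /andP[x16 xu]; rewrite Ez.
  have x0 : 0 < x by lra.
  have lx := ln_ge1 x16.
  have lu : u <= ln x by rewrite -(expRK u) ler_ln ?posrE ?expR_gt0.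
  have h : log_cst al th <= ln x `^ (th - 1).
    have -> : log_cst al th = u `^ (th - 1).
      by rewrite /u -powRrM mulVf ?gt_eqF// powRr1//; lra.
    by apply: ge0_ler_powR; rewrite ?nnegrE ?powR_ge0//; lra.
  have -> : ln x `^ th = ln x `^ (th - 1) * ln x.
    by rewrite -[X in _ = _ * X]powRr1 ?powRDp ?subrK//; lra.
  set p := x `^ _; have p0 : 0 <= p by apply: powR_ge0.
  have l0 : 0 <= ln x by lra.
  have -> : log_cst al th * (ln x * p) = log_cst al th * (p * ln x) by ring.
  have -> : log_cst al 1 * (p * (ln x `^ (th - 1) * ln x))
     = log_cst al 1 * ln x `^ (th - 1) * (p * ln x) by ring.
  apply: ler_wpM2r; first exact: mulr_ge0.
  by apply: le_trans h _; rewrite ler_peMl ?powR_ge0//; lra.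
have alp : 0 < al by rewrite lt_def aln0.
pose e := al / 3 / (3 - al).
have e0 : 0 < e by rewrite !divr_gt0//; lra.
pose c := log_cst al th / (e / 2).
have c0 : 0 < c by rewrite divr_gt0 ?divr_gt0//; lra.
exists (Num.max 16 (c `^ (e / 2)^-1)); first by rewrite le_max lexx.
move=> x; rewrite ge_max => /andP[x16 xc].
have x0 : 0 < x by lra.
have lx := ln_ge1 x16.
have e20 : 0 < e / 2 by rewrite divr_gt0.
have h1 := ln_le_powR x0 e20.
have h2 : c <= x `^ (e / 2).
  have -> : c = (c `^ (e / 2)^-1) `^ (e / 2).
    by rewrite -powRrM mulVf ?gt_eqF// powRr1// ltW.
  by apply: ge0_ler_powR; rewrite ?nnegrE ?powR_ge0 ?(ltW e20) ?(ltW x0).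
have h3 : log_cst al th * ln x <= x `^ e.
  have -> : x `^ e = x `^ (e / 2) * x `^ (e / 2).
    by rewrite powRDp//; congr (_ `^ _); field.
  apply: (@le_trans _ _ (c * x `^ (e / 2))); last by rewrite ler_wpM2r ?powR_ge0.
  have -> : c * x `^ (e / 2) = log_cst al th * (x `^ (e / 2) / (e / 2)).
    by rewrite /c; ring.
  by rewrite ler_wpM2l//; lra.
have Ez : x `^ ((1 + al) / (3 - al)) = x `^ e * cutoff al x `^ (1 + 2 * al / 3).
  rewrite cutoff_powR powRDp//; congr (_ `^ _); rewrite /e; field.
  by rewrite gt_eqF//; lra.
have lt1 : 1 <= ln x `^ th by rewrite -[leLHS](powRr0 (ln x)) ler_powR.
set w := cutoff al x `^ _ in Ez *; have w0 : 0 <= w by apply: powR_ge0.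
rewrite Ez mulrA; apply: (@le_trans _ _ (x `^ e * w)); first by rewrite ler_wpM2r.
have q0 : 0 <= x `^ e * w by rewrite mulr_ge0 ?powR_ge0.
apply: (@le_trans _ _ (x `^ e * w * ln x `^ th)); first by rewrite ler_peMr.
rewrite ler_peMl//; last by lra.
by rewrite mulr_ge0//; lra.
Qed.

Lemma main_bound al : 0 <= al < 1 -> exists K : R, forall th, 0 <= th ->
  exists2 x0 : R, 16 <= x0 &
  forall a A, (forall d, 0 <= a d) -> summatory_bound a A al th ->
  forall x N, x0 <= x -> x < N%:R ->
  \sum_(1 <= d < N) a d * `|mult_count x d - x * mult_series R d N|
   <= K * A * (x `^ ((1 + al) / (3 - al)) * ln x `^ log_exp al th).
Proof.
move=> al01; have /andP[al0 al1] := al01.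
have [Cs Cs0 HS] := small_divisors al01.
have [Cm Cm0 HM] := middle_divisors al01.
have [Ct Ct0 HT] := large_divisors al01.
exists (Cs * log_cst al 1 + Cm + Ct * log_cst al 1) => th th0.
have [x0 x016 Hx0] := log_cst_absorb al01 th0.
exists x0 => // a A a0 HA x N x0x xN.
have x16 : 16 <= x by lra.
have xp : 0 < x by lra.
have lx := ln_ge1 x16.
have A0 := summatory_cst_ge0 a0 HA.
have [z1 zx z2 zlex] := cutoffP al01 x16.
have S := HS a A th th0 a0 HA x N x16 xN.
have M := HM a A th th0 a0 HA x N x16.
have T := HT a A th th0 a0 HA x N x16.
have Ab := Hx0 x x0x.
set w := cutoff al x `^ (1 + 2 * al / 3) in S Ab.
set P := x `^ ((1 + al) / (3 - al)) * ln x `^ log_exp al th in Ab *.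
have w1 : 1 <= w by rewrite -[leLHS](powRr0 (cutoff al x)) ler_powR//; lra.
have lc : 0 <= log_cst al th by have := log_cst_ge2 th al01; lra.
have Mp : ln x `^ th * cutoff al x `^ (1 + al) <= P.
  rewrite cutoff_powR mulrC /P ler_wpM2l ?powR_ge0// ler_powR//; exact: log_exp_ge.
have Tp : log_cst al th <= log_cst al 1 * P.
  by apply: le_trans Ab; rewrite ler_peMr//; nra.
have zX : (Num.truncn (cutoff al x) <= (Num.truncn x).+1)%N.
  by apply: leqW; apply: le_truncn.
have z0 : (1 <= Num.truncn (cutoff al x))%N by rewrite truncn_gt0.
have XN : ((Num.truncn x).+1 <= N)%N.
  by rewrite truncn_lt_nat// ltW.
rewrite (big_cat_nat (leq_trans z0 zX) XN)/= (big_cat_nat z0 zX)/=.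
apply: le_trans (lerD (lerD S M) T) _.
have -> : (Cs * log_cst al 1 + Cm + Ct * log_cst al 1) * A * P =
  Cs * A * (log_cst al 1 * P) + Cm * A * P + Ct * A * (log_cst al 1 * P) by ring.
have CA0 C : 0 <= C -> 0 <= C * A by move=> C0; rewrite mulr_ge0.
apply: lerD; first apply: lerD.
- have -> : Cs * (A * log_cst al th) * (ln x * w) = Cs * A * (log_cst al th * (ln x * w)) by ring.
  by rewrite ler_wpM2l ?CA0.
- by rewrite mulrA ler_wpM2l ?CA0.
- by rewrite mulrA ler_wpM2l ?CA0.
Qed.

End MainBound.

(** * Exchanging the sums over divisors *)

Section Complex.
Variable R : realType.
Implicit Types (f g : nat -> R[i]) (x : R) (d n m N : nat).

Lemma sum_divisors g n N : (0 < n)%N -> (n < N)%N ->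
  \sum_(d <- divisors n) g d = \sum_(1 <= d < N) g d * (d %| n)%:R.
Proof.
move=> n0 nN.
have E : perm_eq (divisors n) [seq d <- index_iota 1 N | (d %| n)%N].
  apply: uniq_perm; rewrite ?divisors_uniq ?filter_uniq ?iota_uniq// => d.
  rewrite -dvdn_divisors// mem_filter mem_index_iota.
  case: (boolP (d %| n)%N) => //= dn.
  by rewrite (dvdn_gt0 n0 dn)/= (leq_ltn_trans (dvdn_leq n0 dn) nN).
rewrite (perm_big _ E)/= big_filter big_mkcond /=.
by apply: eq_bigr => d _; case: (d %| n)%N; rewrite ?mulr1 ?mulr0.
Qed.

Variables (f g : nat -> R[i]).
Hypothesis fg : forall n, (0 < n)%N -> f n = \sum_(d <- divisors n) g d.

Lemma natdivC (p q : nat) : (p%:R / q%:R : R)%:C = p%:R / q%:R.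
Proof. by rewrite rmorphM fmorphV !rmorph_nat. Qed.

Lemma floor_sumE x N : 0 <= x -> x < N%:R ->
  floor_sum f x = \sum_(1 <= d < N) g d * (mult_count x d)%:C.
Proof.
move=> x0 xN; rewrite /floor_sum.
transitivity (\sum_(1 <= n < (Num.truncn x).+1) \sum_(1 <= d < N)
   g d * (d %| Num.truncn (x / n%:R))%:R).
  apply: eq_big_nat => n /andP[n0 nX].
  have q0 : (0 < Num.truncn (x / n%:R))%N by rewrite -truncn_div_swap// divr1 -ltnS.
  rewrite fg// (sum_divisors g q0 (N := N))//.
  rewrite truncn_lt_nat ?divr_ge0//; apply: le_lt_trans xN.
  by rewrite ler_pdivrMr ?ltr0n// ler_peMr// ler1n.
rewrite exchange_big /=; apply: eq_bigr => d _.
rewrite -big_distrr /= /mult_count rmorph_sum /=; congr (_ * _).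
by apply: eq_bigr => n _; rewrite rmorph_nat.
Qed.

Lemma floor_cst_partialE N :
  floor_cst_partial f N = \sum_(1 <= d < N) g d * (mult_series R d N)%:C.
Proof.
rewrite /floor_cst_partial.
transitivity (\sum_(1 <= n < N) \sum_(1 <= d < N)
   g d * ((d %| n)%:R / (n * n.+1)%:R : R)%:C).
  apply: eq_big_nat => n /andP[n0 nN].
  rewrite fg// (sum_divisors g n0 nN) big_distrl /=; apply: eq_bigr => d _.
  by rewrite natdivC mulrA.
rewrite exchange_big /=; apply: eq_bigr => d _.
by rewrite -big_distrr /= /mult_series rmorph_sum.
Qed.

Lemma cabs_floor_sum x N : 0 <= x -> x < N%:R ->
  cabs (floor_sum f x - floor_cst_partial f N * x%:C) <=
    \sum_(1 <= d < N) cabs (g d) * `|mult_count x d - x * mult_series R d N|.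
Proof.
move=> x0 xN; rewrite (floor_sumE x0 xN) floor_cst_partialE big_distrl /= -sumrB.
apply: le_trans (cabs_sum _ _ _) _; apply: ler_sum => d _.
rewrite -mulrA -rmorphM -mulrBr -rmorphB cabsM cabsR.
by rewrite (mulrC x).
Qed.

Lemma partial_terms_bound N :
  \sum_(1 <= n < N) cabs (f n / (n * n.+1)%:R) <= \sum_(1 <= d < N) cabs (g d) * mult_series R d N.
Proof.
apply: (@le_trans _ _ (\sum_(1 <= n < N) \sum_(1 <= d < N)
   cabs (g d) * ((d %| n)%:R / (n * n.+1)%:R))).
  apply: ler_sum_nat => n /andP[n0 nN].
  rewrite fg// (sum_divisors g n0 nN) big_distrl /=.
  apply: le_trans (cabs_sum _ _ _) _; apply: ler_sum => d _.
  have -> : g d * (d %| n)%:R / (n * n.+1)%:R = g d * ((d %| n)%:R / (n * n.+1)%:R : R)%:C.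
    by rewrite natdivC mulrA.
  by rewrite cabsM cabsR ger0_norm// divr_ge0.
rewrite exchange_big /=; apply: ler_sum => d _.
by rewrite -big_distrr.
Qed.

End Complex.

(** * Convergence of the series, and the asymptotic formula *)

Section Convergence.
Variable R : realType.

Lemma cabs_le_add (p q : R) : cabs (p +i* q) <= `|p| + `|q|.
Proof.
have -> : p +i* q = p%:C + (0 +i* q) by apply/eqP; rewrite eq_complex /= addr0 add0r !eqxx.
apply: le_trans (cabsD _ _) _; rewrite cabsR lerD2l cabsE /=.
by rewrite expr0n add0r sqrtr_sqr.
Qed.

(** The real and the imaginary parts converge absolutely; the limit of the complex
    series is assembled from theirs. *)
Lemma cvg_complex_series (u : nat -> R[i]) (B : R) :
  (forall N, \sum_(0 <= n < N) cabs (u n) <= B) ->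
  cvgn (fun N => \sum_(0 <= n < N) u n : R[i]^o).
Proof.
move=> HB.
have real_cvg (v : nat -> R) : (forall n, `|v n| <= cabs (u n)) ->
    cvgn (series v).
  move=> hv; apply: (@normed_cvg R R^o).
  apply: (@nondecreasing_is_cvgn R (fun N => \sum_(0 <= n < N) `|v n|)).
    by apply/nondecreasing_seqP => n; rewrite big_nat_recr//= lerDl.
  exists B => _ [n _ <-].
  by apply: le_trans (HB n); apply: ler_sum => i _.
have hRe n : `|complex.Re (u n)| <= cabs (u n) by apply: Re_le_cabs.
have hIm n : `|complex.Im (u n)| <= cabs (u n).
  rewrite cabsE -sqrtr_sqr ler_wsqrtr// lerDr sqr_ge0//.
have cR := real_cvg _ hRe; have cI := real_cvg _ hIm.
set a := limn _ in cR; set b := limn _ in cI.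
apply/cvg_ex; exists ((a +i* b) : R[i]^o).
apply/cvgrPdist_lt => e e0.
have [r r0 Er] : exists2 r : R, 0 < r & e = r%:C.
  move: e0; case: e => p q; rewrite ltcE /= => /andP[/eqP -> p0].
  by exists p.
have r2 : 0 < r / 2 by rewrite divr_gt0.
move/cvgrPdist_lt : cR => /(_ _ r2) cR; move/cvgrPdist_lt : cI => /(_ _ r2) cI.
near=> N.
have hp : `|a - series (fun n => complex.Re (u n)) N| < r / 2 by near: N.
have hq : `|b - series (fun n => complex.Im (u n)) N| < r / 2 by near: N.
rewrite Er normCE ltcR.
have -> : \sum_(0 <= n < N) u n = (series (fun n => complex.Re (u n)) N)
    +i* (series (fun n => complex.Im (u n)) N).
  rewrite !seriesEnat /=; elim: (N) => [|m IH]; first by rewrite !big_geq.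
  by rewrite !big_nat_recr//= IH; case: (u m).
move: hp hq; set p := a - _; set q := b - _ => hp hq.
apply: (@le_lt_trans _ _ (`|p| + `|q|)); last by rewrite (splitr r) ltrD.
exact: cabs_le_add.
Unshelve. all: by end_near.
Qed.

Lemma floor_cst_cvg (f g : nat -> R[i]) (A al th : R) : 0 <= al < 1 -> 0 <= th ->
  (forall n : nat, (0 < n)%N -> f n = \sum_(d <- divisors n) g d) ->
  summatory_bound (fun d => cabs (g d)) A al th ->
  cvgn (floor_cst_partial f).
Proof.
move=> al01 th0 fg HA; have /andP[al0 al1] := al01.
have a0 d : 0 <= cabs (g d) by apply: cabs_ge0.
pose be := al + (1 - al) / 6.
have be0 : 0 <= be by rewrite /be; lra.
have be1 : be < 1 by rewrite /be; lra.
pose C : R := 2 `^ be / (1 - 2 `^ (be - 1)) * (A * log_cst al th * 1%:R `^ (be - 1)).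
have B X : \sum_(1 <= d < X) cabs (g d) * d%:R `^ (- 1) <= C.
  exact: (dyadic_tail be0 be1 a0 (summatory_pow al01 th0 a0 HA)).
have -> : floor_cst_partial f = fun N => \sum_(0 <= n < N) (f n / (n * n.+1)%:R) : R[i]^o.
  apply/funext => -[|N]; first by rewrite /floor_cst_partial !big_geq.
  by rewrite /floor_cst_partial [RHS]big_ltn// mul0n invr0 mulr0 add0r.
apply: (@cvg_complex_series _ (2 * C)) => N.
have HN M : \sum_(1 <= d < M) cabs (g d) * mult_series R d M <= 2 * C.
  apply: le_trans (ler_wpM2l (ler0n R 2) (B M)); rewrite big_distrr /=.
  apply: ler_sum_nat => d /andP[d0 _]; have dr0 : 0 < d%:R :> R by rewrite ltr0n.
  rewrite [leRHS]mulrCA ler_wpM2l// powR_inv1 ?ler0n//.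
  apply: le_trans (mult_series_le R M d0) _.
  rewrite ler_wpM2l// lef_pV2 ?posrE ?exprn_gt0//.
  by rewrite expr2 ler_peMr ?ler1n// ltW.
case: N => [|N]; first by have := HN 0%N; rewrite !big_geq.
rewrite big_ltn// mul0n invr0 mulr0 cabs0 add0r.
exact: le_trans (partial_terms_bound fg _) (HN _).
Qed.

End Convergence.

Theorem theorem2 (R : realType) (alpha : R) (halpha : 0 <= alpha < 1) :
  exists K : R, forall theta : R, 0 <= theta ->
  exists x0 : R, forall (f g : nat -> R[i]) (A : R),
    (forall n : nat, (0 < n)%N -> f n = \sum_(d <- divisors n) g d) ->
    (forall x : R, 2 <= x ->
       \sum_(1 <= d < (Num.truncn x).+1) `|g d|
         <= (A * (x `^ alpha * ln x `^ theta))%:C) ->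
    cvgn (floor_cst_partial f) /\
    (forall x : R, x0 <= x ->
       `|floor_sum f x - floor_cst f * x%:C|
         <= (K * A * (x `^ ((1 + alpha) / (3 - alpha))
                      * ln x `^ (if alpha == 0 then Num.max 1 theta
                                 else theta)))%:C).
Proof.
have [K HK] := main_bound halpha.
exists K => theta theta0; have [x0 x016 Hx0] := HK theta theta0.
exists x0 => f g A fg gA.
have HA : summatory_bound (fun d => cabs (g d)) A alpha theta.
  move=> x x2; have := gA x x2.
  have -> : \sum_(1 <= d < (Num.truncn x).+1) `|g d|
      = (\sum_(1 <= d < (Num.truncn x).+1) cabs (g d))%:C.
    by rewrite rmorph_sum.
  by rewrite lecR.
have cvg_partial := floor_cst_cvg halpha theta0 fg HA.
split=> // x x0x; rewrite normCE lecR.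
have xp : 0 < x by lra.
(* The bound of main_bound is uniform in the length N of the partial sums of
   the constant, hence passes to their limit. *)
apply/ler_addgt0Pr => e e0.
have ex0 : 0 < (e / x)%:C :> R[i] by rewrite ltcR divr_gt0.
have /cvgrPdist_lt/(_ _ ex0) near_lim := cvg_partial.
near \oo => N.
have xN : x < N%:R.
  by apply: lt_le_trans (truncnS_gt x) _; rewrite ler_nat; near: N; apply: nbhs_infty_ge.
have lN : cabs (floor_cst f - floor_cst_partial f N) < e / x.
  by rewrite -ltcR -normCE; near: N.
have -> : floor_sum f x - floor_cst f * x%:C =
  (floor_sum f x - floor_cst_partial f N * x%:C)
   - (floor_cst f - floor_cst_partial f N) * x%:C by ring.
apply: le_trans (cabsB _ _) _; apply: lerD.
  apply: le_trans (cabs_floor_sum fg (ltW xp) xN) _.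
  by apply: Hx0 => // d; apply: cabs_ge0.
rewrite cabsM cabsR gtr0_norm// -ler_pdivlMr//; exact: ltW.
Unshelve. all: by end_near.
Qed.
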